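(* Let $(M,\mathcal D,\mathcal F,g)$ be a closed codimension-one foliated sub-Riemannian manifold with $\mathcal D=T\mathcal F\oplus\mathrm{span}(N)$, such that the orthogonal distribution $\mathcal D^\bot$ is harmonic. Then $$\int_M\sigma_1\,d\mathrm{vol}_g=0 .$$
   Context: Setting: $(M,g)$, $g=\langle\cdot,\cdot\rangle$, is a smooth $m$-dimensional Riemannian manifold with Levi-Civita connection $\nabla$; $\mathcal D\subset TM$ is a smooth distribution (subbundle) of rank $n+1$, $0<n<m$; $\mathcal F$ is an $n$-dimensional foliation of $M$ with $T\mathcal F\subset\mathcal D$; $N$ is a globally defined smooth unit vector field tangent to $\mathcal D$ and orthogonal to $\mathcal F$, so that $\mathcal D=T\mathcal F\oplus\mathrm{span}(N)$ orthogonally. Such $(M,\mathcal D,\mathcal F,g)$ is called a codimension-one foliated sub-Riemannian manifold; it is closed if $M$ is compact without boundary. $P:TM\to\mathcal D$ is the orthoprojector, and $\mathcal D^\bot$ is the $g$-orthogonal complement of $\mathcal D$ in $TM$. Shape operator: $A:T\mathcal F\to T\mathcal F$, $A(X)=-P\nabla_XN$, and $\sigma_1=\mathrm{tr}\,A$. The mean curvature vector field of $\mathcal D^\bot$ is $H^\bot=\sum_a P\nabla_{\xi_a}\xi_a$, where $\{\xi_a\}$ is a local orthonormal frame of $\mathcal D^\bot$; $\mathcal D^\bot$ is harmonic if $H^\bot=0$. *)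

(* Defs.v *)
From HB Require Import structures.
From mathcomp Require Import all_boot all_order all_algebra.
From mathcomp Require Import all_classical all_reals all_analysis.
From mathcomp Require Import ring.
Set Implicit Arguments.
Unset Strict Implicit.
Unset Printing Implicit Defensive.
Import Order.TTheory GRing.Theory Num.Theory.
Import numFieldNormedType.Exports.
Local Open Scope classical_set_scope.
Local Open Scope ring_scope.

(* Needed because the instance on [m1 \x m2] for probabilities shadows the
   sigma-finite one. *)
Lemma sigma_finite_prod d1 d2 (T1 : measurableType d1) (T2 : measurableType d2)
    (R : realType) (m1 : {sigma_finite_measure set T1 -> \bar R})
    (m2 : {sigma_finite_measure set T2 -> \bar R}) :
  sigma_finite setT (m1 \x m2)%E.
Proof.
have /sigma_finiteP[F [TF ndF Foo]] := sigma_finiteT m1.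
have /sigma_finiteP[G [TG ndG Goo]] := sigma_finiteT m2.
exists (fun n => F n `*` G n).
  rewrite -setXTT TF TG predeqE => -[x y]; split.
    move=> [/= [n _ Fnx] [k _ Gky]]; exists (maxn n k) => //; split.
    - by move: x Fnx; exact/subsetPset/ndF/leq_maxl.
    - by move: y Gky; exact/subsetPset/ndG/leq_maxr.
  by move=> [n _ []/= ? ?]; split; exists n.
move=> k; have [? ?] := Foo k; have [? ?] := Goo k.
split; first exact: measurableX.
by rewrite product_measure1E// lte_mul_pinfty// ge0_fin_numE.
Qed.

Section lebesgue_tuple.
Context (R : realType).
Local Open Scope ereal_scope.

Definition tuple_cons n (x : R * n.-tuple R) : n.+1.-tuple R :=
  [tuple of x.1 :: x.2].

Lemma measurable_tuple_cons n : measurable_fun setT (@tuple_cons n).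
Proof. exact: measurable_cons. Qed.

Section step.
Variables (n : nat) (mu : {sigma_finite_measure set (n.-tuple R) -> \bar R}).

Definition lebesgue_cons : set (n.+1.-tuple R) -> \bar R :=
  pushforward (@lebesgue_measure R \x mu) (@tuple_cons n).

Let lc0 : lebesgue_cons set0 = 0.
Proof. by rewrite /lebesgue_cons /pushforward preimage_set0 measure0. Qed.

Let lc_ge0 A : 0 <= lebesgue_cons A.
Proof. by rewrite /lebesgue_cons /pushforward measure_ge0. Qed.

Let lc_preim A : measurable A -> measurable (@tuple_cons n @^-1` A).
Proof.
by move=> mA; rewrite -[X in measurable X]setTI; exact: measurable_tuple_cons.
Qed.

Let lc_additive : semi_sigma_additive lebesgue_cons.
Proof.
move=> F mF tF mUF; rewrite /lebesgue_cons /pushforward preimage_bigcup.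
apply: measure_semi_sigma_additive.
- by move=> i; exact: lc_preim.
- apply/trivIsetP => /= i j _ _ ij; rewrite -preimage_setI.
  by move/trivIsetP : tF => /(_ _ _ _ _ ij) ->//; rewrite preimage_set0.
- by rewrite -preimage_bigcup; exact: lc_preim.
Qed.

HB.instance Definition _ := isMeasure.Build _ _ _
  lebesgue_cons lc0 lc_ge0 lc_additive.

Let lc_sigma_finite : sigma_finite setT lebesgue_cons.
Proof.
have [F UF Ffin] := sigma_finite_prod (@lebesgue_measure R) mu.
pose u (t : n.+1.-tuple R) : R * n.-tuple R := (thead t, [tuple of behead t]).
have uK : cancel u (@tuple_cons n) by move=> t; apply/val_inj; case/tupleP: t.
have consK : cancel (@tuple_cons n) u.
  by case=> x t; rewrite /u theadE; congr pair; exact/val_inj.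
have mu_ : measurable_fun setT u.
  apply/measurable_fun_pairP; split; first exact: measurable_tnth.
  exact: measurable_behead.
exists (fun i => u @^-1` F i).
  by rewrite -preimage_bigcup -UF preimage_setT.
move=> i; have [mF Foo] := Ffin i; split.
  by rewrite -[X in measurable X]setTI; exact: mu_.
rewrite /lebesgue_cons /pushforward -comp_preimage.
rewrite (_ : u \o _ = id) //; exact/funext.
Qed.

HB.instance Definition _ := Measure_isSigmaFinite.Build _ _ _
  lebesgue_cons lc_sigma_finite.

End step.

(* Lebesgue measure on R^n, as the n-fold product of [lebesgue_measure]. *)
Fixpoint lebesgue_tuple n : {sigma_finite_measure set (n.-tuple R) -> \bar R} :=
  match n with
  | 0 => dirac [tuple]
  | n.+1 => lebesgue_cons (lebesgue_tuple n)
  end.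

End lebesgue_tuple.

Section smooth_maps.
Context (R : realType) (m : nat) (V : normedModType R).
Implicit Types (U : set 'rV[R]_m) (f : 'rV[R]_m -> V).

(* For [U] open. *)
Fixpoint C_on (k : nat) U f : Prop :=
  match k with
  | 0 => forall x, U x -> {for x, continuous f}
  | k.+1 => (forall x, U x -> differentiable f x) /\
            forall i : 'I_m, C_on k U (fun x => 'D_(delta_mx 0 i) f x)
  end.

Definition smooth_on U f := forall k, C_on k U f.

End smooth_maps.

(* Boundaryless: charts are homeomorphisms onto open subsets of R^m.  Outside
   [cdom] (resp. its image) the total maps [cfwd] and [cbwd] carry no meaning. *)
Record chart (R : realType) (M : topologicalType) (m : nat) := Chart {
  cdom : set M;
  cfwd : M -> 'rV[R]_m;
  cbwd : 'rV[R]_m -> M;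
  cdom_open : open cdom;
  cimg_open : open (cfwd @` cdom);
  cfwdK : forall p, cdom p -> cbwd (cfwd p) = p;
  cfwd_cont : forall p, cdom p -> {for p, continuous cfwd};
  cbwd_cont : forall x, (cfwd @` cdom) x -> {for x, continuous cbwd}
}.

Section transition.
Context (R : realType) (M : topologicalType) (m : nat).
Implicit Types c d : chart R M m.

Definition transition c d : 'rV[R]_m -> 'rV[R]_m := cfwd d \o cbwd c.

Definition overlap c d : set 'rV[R]_m := cfwd c @` (cdom c `&` cdom d).

Definition compatible c d :=
  smooth_on (overlap c d) (transition c d) /\
  smooth_on (overlap d c) (transition d c).

End transition.

Record smooth_structure (R : realType) (M : topologicalType) (m : nat) :=
  SmoothStructure {
  atlas : set (chart R M m);
  chart_at : M -> chart R M m;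
  atlas_chart_at : forall p, atlas (chart_at p);
  mem_chart_at : forall p, cdom (chart_at p) p;
  atlas_compatible : forall c d, atlas c -> atlas d -> compatible c d;
  manifold_hausdorff : hausdorff_space M;
  manifold_second_countable : @second_countable M
}.

Lemma sum_invmxM (K : fieldType) m (G : 'M[K]_m) (w : 'I_m -> K) b :
  G^T = G -> G \in unitmx ->
  \sum_l (\sum_h invmx G l h * w h) * G l b = w b.
Proof.
move=> GT GU; pose v := \col_h w h.
transitivity (((invmx G *m v)^T *m G) 0 b).
  by rewrite mxE; apply: eq_bigr => l _; rewrite !mxE; congr (_ * _);
     apply: eq_bigr => h _; rewrite mxE.
by rewrite -{2}GT -trmx_mul mulmxA mulmxV// mul1mx !mxE.
Qed.

Section geometry.
Context (R : realType) (M : topologicalType) (m : nat).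
Variable S : smooth_structure R M m.

(* The tangent space at [p] is 'rV[R]_m, a tangent vector being identified with
   its components in the chart [chart_at S p]; the components of [v] in another
   chart [c] around [p] are [v *m to_chart c p].  A vector field is a function
   [M -> 'rV[R]_m], a linear endomorphism of the tangent space a matrix acting
   on row vectors, and a subspace the row space of a square matrix. *)
Definition to_chart (c : chart R M m) (p : M) : 'M[R]_m :=
  'J (transition (chart_at S p) c) (cfwd (chart_at S p) p).

Definition vf_loc (c : chart R M m) (X : M -> 'rV[R]_m) (x : 'rV[R]_m) :=
  X (cbwd c x) *m to_chart c (cbwd c x).

Definition smooth_vf (U : set M) (X : M -> 'rV[R]_m) :=
  forall c, atlas S c -> smooth_on (cfwd c @` (cdom c `&` U)) (vf_loc c X).

Definition inner (g : M -> 'M[R]_m) (p : M) (u v : 'rV[R]_m) : R :=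
  (u *m g p *m v^T) 0 0.

Definition metric_loc (g : M -> 'M[R]_m) (c : chart R M m) (x : 'rV[R]_m) :=
  let p := cbwd c x in
  invmx (to_chart c p) *m g p *m (invmx (to_chart c p))^T.

Definition riemannian_metric (g : M -> 'M[R]_m) :=
  [/\ forall p, (g p)^T = g p,
      forall p (v : 'rV[R]_m), v != 0 -> 0 < inner g p v v &
      forall c, atlas S c -> smooth_on (cfwd c @` cdom c) (metric_loc g c)].

Definition partial (i : 'I_m) (f : 'rV[R]_m -> R) (x : 'rV[R]_m) : R :=
  'D_(delta_mx 0 i) f x.

(* The Christoffel symbol with upper index [k] and lower indices [i], [j]. *)
Definition christoffel (g : M -> 'M[R]_m) (c : chart R M m) (x : 'rV[R]_m)
    (k i j : 'I_m) : R :=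
  2^-1 * \sum_l invmx (metric_loc g c x) k l *
    (partial i (fun y => metric_loc g c y j l) x +
     partial j (fun y => metric_loc g c y i l) x -
     partial l (fun y => metric_loc g c y i j) x).

Lemma metric_loc_sym g c x :
  (forall p, (g p)^T = g p) -> (metric_loc g c x)^T = metric_loc g c x.
Proof.
by move=> gT; rewrite /metric_loc !trmx_mul trmxK gT mulmxA.
Qed.

(* The two identities characterizing the Levi-Civita connection: vanishing
   torsion and metric compatibility. *)
Lemma christoffelC g c x k i j : (forall p, (g p)^T = g p) ->
  christoffel g c x k i j = christoffel g c x k j i.
Proof.
move=> gT; rewrite /christoffel; congr (_ * _); apply: eq_bigr => l _.
congr (_ * _); rewrite [X in X - _]addrC; congr (_ - _).
congr (partial _ _ _); apply/funext => y.
by rewrite -[in LHS](metric_loc_sym c y gT) mxE.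
Qed.

Lemma christoffel_metric g c x k i j :
  (forall p, (g p)^T = g p) -> metric_loc g c x \in unitmx ->
  partial k (fun y => metric_loc g c y i j) x =
  \sum_l (christoffel g c x l k i * metric_loc g c x l j +
          christoffel g c x l k j * metric_loc g c x i l).
Proof.
move=> gT gU.
have gE y a b : metric_loc g c y a b = metric_loc g c y b a.
  by rewrite -[in LHS](metric_loc_sym c y gT) mxE.
have gEf a b : (fun y => metric_loc g c y a b) = (fun y => metric_loc g c y b a).
  by apply/funext => y; exact: gE.
have lower a b : \sum_l christoffel g c x l k a * metric_loc g c x l b =
    2^-1 * (partial k (fun y => metric_loc g c y a b) x +
            partial a (fun y => metric_loc g c y k b) x -
            partial b (fun y => metric_loc g c y k a) x).
  pose w l := partial k (fun y => metric_loc g c y a l) x +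
              partial a (fun y => metric_loc g c y k l) x -
              partial l (fun y => metric_loc g c y k a) x.
  transitivity (2^-1 * \sum_l (\sum_h invmx (metric_loc g c x) l h * w h) *
                               metric_loc g c x l b).
    rewrite mulr_sumr; apply: eq_bigr => l _.
    by rewrite /christoffel -mulrA.
  by rewrite sum_invmxM //; exact: metric_loc_sym.
rewrite big_split /= lower.
under [X in _ + X]eq_bigr do rewrite (gE x i).
rewrite lower (gEf j i) -mulrDr.
set u := partial k _ x.
set v := partial i (fun y => metric_loc g c y k j) x.
set w := partial j (fun y => metric_loc g c y k i) x.
by field.
Qed.

(* The endomorphism v |-> nabla_v Y of the tangent space at [p], for the
   Levi-Civita connection of [g]. *)
Definition nabla (g : M -> 'M[R]_m) (Y : M -> 'rV[R]_m) (p : M) : 'M[R]_m :=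
  let c := chart_at S p in
  let x := cfwd c p in
  \matrix_(i, k) (partial i (fun y => vf_loc c Y y 0 k) x +
                  \sum_j christoffel g c x k i j * vf_loc c Y x 0 j).

(* [C] is spanned near every point by [r] smooth fields independent there. *)
Definition smooth_distribution (r : nat) (C : M -> 'M[R]_m) :=
  (forall p, \rank (C p) = r) /\
  forall p, exists U (X : 'I_r -> M -> 'rV[R]_m),
    [/\ open U, U p, forall a, smooth_vf U (X a) &
        forall q, U q -> (C q == \matrix_(a < r) X a q)%MS].

Definition orth (g : M -> 'M[R]_m) (C : M -> 'M[R]_m) (p : M) : 'M[R]_m :=
  kermx (g p *m (C p)^T).

Definition orthoproj (g : M -> 'M[R]_m) (C : M -> 'M[R]_m) (p : M) : 'M[R]_m :=
  proj_mx (C p) (orth g C p).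

(* The first [n] coordinates of a foliated chart run along the leaves:
   [y *m copid_mx n] keeps only the remaining, transverse, coordinates, and
   changes of foliated charts locally preserve the plaques. *)
Record foliation (n : nat) := Foliation {
  fol_atlas : set (chart R M m);
  fol_at : M -> chart R M m;
  fol_atlas_fol_at : forall p, fol_atlas (fol_at p);
  mem_fol_at : forall p, cdom (fol_at p) p;
  fol_compatible : forall c d, fol_atlas c -> atlas S d -> compatible c d;
  fol_plaques : forall c d, fol_atlas c -> fol_atlas d ->
    forall x, overlap c d x ->
    exists2 W : set 'rV[R]_m, nbhs x W &
      forall y z, W y -> W z -> y *m copid_mx n = z *m copid_mx n ->
        transition c d y *m copid_mx n = transition c d z *m copid_mx n
}.

(* Tangent space of the leaf through [p]. *)
Definition fol_tangent n (F : foliation n) (p : M) : 'M[R]_m :=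
  kermx (to_chart (fol_at F p) p *m copid_mx n).

Definition shape_operator (g : M -> 'M[R]_m) (D : M -> 'M[R]_m)
    (N : M -> 'rV[R]_m) (p : M) : 'M[R]_m :=
  - (nabla g N p *m orthoproj g D p).

Definition sigma1 (g : M -> 'M[R]_m) (D : M -> 'M[R]_m) n (F : foliation n)
    (N : M -> 'rV[R]_m) (p : M) : R :=
  \tr (restrictmx (fol_tangent F p) (shape_operator g D N p)).

Definition orthonormal_frame (g : M -> 'M[R]_m) (C : M -> 'M[R]_m)
    (U : set M) (r : nat) (xi : 'I_r -> M -> 'rV[R]_m) :=
  [/\ open U, forall a, smooth_vf U (xi a),
      forall q, U q -> (C q == \matrix_(a < r) xi a q)%MS &
      forall q, U q -> forall a b, inner g q (xi a q) (xi b q) = (a == b)%:R].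

(* [h] is the value at [p] of the mean curvature vector field of the orthogonal
   complement of [D]; the sum below does not depend on the frame. *)
Definition mean_curvature_perp_at (g : M -> 'M[R]_m) (D : M -> 'M[R]_m)
    (p : M) (h : 'rV[R]_m) :=
  exists U r (xi : 'I_r -> M -> 'rV[R]_m),
    [/\ U p, orthonormal_frame g (orth g D) U xi &
        h = \sum_a xi a p *m nabla g (xi a) p *m orthoproj g D p].

Definition perp_harmonic (g : M -> 'M[R]_m) (D : M -> 'M[R]_m) :=
  forall p, mean_curvature_perp_at g D p 0.

End geometry.

Section volume.
Context (R : realType) (M : ptopologicalType) (m : nat).
Local Open Scope ereal_scope.

Notation borelType := (g_sigma_algebraType (@open M)).

(* dvol_g is the Borel measure with density sqrt (det g_ij) in every chart. *)
Definition riemannian_volume (S : smooth_structure R M m) (g : M -> 'M[R]_m)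
    (vol : {measure set borelType -> \bar R}) :=
  forall c (A : set borelType), atlas S c -> measurable A -> A `<=` cdom c ->
    vol A = \int[lebesgue_tuple R m]_(t in
               [set t | (cfwd c @` A) (\row_i tnth t i)])
              (Num.sqrt (\det (metric_loc S g c (\row_i tnth t i))))%:E.

End volume.

(* Main.v *)
Require Import Defs.
From HB Require Import structures.
From mathcomp Require Import all_boot all_order all_algebra.
From mathcomp Require Import all_classical all_reals all_analysis.
From mathcomp Require Import measurable_realfun.
From mathcomp Require Import ring lra.
Set Implicit Arguments.
Unset Strict Implicit.
Unset Printing Implicit Defensive.
Import Order.TTheory GRing.Theory Num.Theory.
Import numFieldNormedType.Exports.
Local Open Scope classical_set_scope.
Local Open Scope ring_scope.

(** The function sigma1 is, up to sign, a divergence, and the integral of a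
    divergence over a closed manifold vanishes.

    Pointwise part.  Near p choose an orthonormal frame xi_a of the orthogonal
    complement of D.  The tangent space at p splits orthogonally into T F, the
    line of N and the span of the xi_a, and tr (nabla N) is the sum of the traces
    over the three pieces.  The first piece contributes - sigma1.  The second
    contributes <nabla_N N, N>, which is zero because <N, N> is constant.  The
    third is the sum of the <nabla_(xi_a) N, xi_a>; since <N, xi_a> is zero near p
    it equals - <N, sum_a nabla_(xi_a) xi_a> = - <N, H>, where only the projection
    H to D matters because N lies in D, and H is zero by harmonicity.  The linear
    algebra is tr_conjmx_adapted, the differentiation of constant inner products
    is nabla_inner_cst, and together they give sigma1_divg: sigma1 = - div N.

    Divergence theorem.  In a chart the trace of the Christoffel symbols is the
    logarithmic derivative of sqrt (det g) (trace_christoffel, and Jacobi's formula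
    partial_det), so that sqrt (det g) div Y is the Euclidean divergence of
    sqrt (det g) Y (divergence_sqrt_det).  The tangent space at each point is read
    in a chart that depends on the point; that one fixed chart may be used around
    a point instead is divg_chart, whose content is the coordinate invariance
    of the divergence, divergence_change.  There the second derivatives of the
    change of coordinates cancel by Schwarz's theorem, partialC.

    For a field supported in a coordinate ball, the description of the volume by
    its density in a chart turns the integral into a sum of Lebesgue integrals of
    partial derivatives of compactly supported functions; these vanish by Fubini
    and the fundamental theorem of calculus (integral_partial_tuple,
    integral_divg_chart).  For a general field Y, compactness provides finitely
    many coordinate balls and C1 bump functions b_1, ..., b_k, such that at every
    point one of the b_i is 1.  Replacing Y by (1 - b_i) Y subtracts from div Y
    the divergence of b_i Y, whose integral is zero; after k replacements the field
    is zero.  This is integral_divg. *)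

(** * Partial derivatives and Schwarz's theorem *)

Section calculus.
Context {R : realType} {m : nat}.
Implicit Types (f : 'rV[R]_m -> R) (x v : 'rV[R]_m).

Lemma is_derive_line f x v (s : R) : differentiable f (x + s *: v) ->
  is_derive s 1 (fun t => f (x + t *: v)) ('D_v f (x + s *: v)).
Proof.
move=> /diff_derivable df.
have E : (fun h : R => h^-1 *: (f (x + (h *: 1 + s) *: v) - f (x + s *: v)))
       = (fun h : R => h^-1 *: (f (h *: v + (x + s *: v)) - f (x + s *: v))).
  apply/funext => h; congr (_ *: (f _ - _)).
  by rewrite (_ : h *: 1 = h) ?scalerDl 1?addrCA//; exact: mulr1.
split; first by rewrite /derivable /= E; exact: df.
by rewrite /derive /= E.
Qed.

Lemma derive_sum_partial f x v : differentiable f x ->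
  'D_v f x = \sum_a v 0 a * partial a f x.
Proof.
move=> df; rewrite deriveE// {1}(row_sum_delta v) linear_sum.
by apply: eq_bigr => a _; rewrite linearZ/= /partial deriveE.
Qed.

Lemma jacobianE n (t : 'rV[R]_m -> 'rV[R]_n) x i a : differentiable t x ->
  'J t x i a = partial i (fun y => t y 0 a) x.
Proof.
move=> dt; have := deriveEjacobian (delta_mx 0 i) dt.
rewrite derive_mx; last exact: diff_derivable.
by rewrite -rowE => /matrixP/(_ 0 a); rewrite !mxE => <-.
Qed.

End calculus.

Section calculus2.
Context {R : realType} {m : nat}.
Implicit Types (f : 'rV[R]_m -> R) (x v : 'rV[R]_m).

Lemma partial_comp n (t : 'rV[R]_m -> 'rV[R]_n) (f : 'rV[R]_n -> R) x i :
  differentiable t x -> differentiable f (t x) ->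
  partial i (fun y => f (t y)) x = \sum_a 'J t x i a * partial a f (t x).
Proof.
move=> dt df; rewrite /partial deriveE; last exact: differentiable_comp.
rewrite (@diff_comp _ _ _ _ t f)//= -(deriveE _ df) derive_sum_partial//.
by apply: eq_bigr => a _; rewrite -deriveE// deriveEjacobian// -rowE mxE.
Qed.

Lemma MVT_line f x v (h : R) : 0 < h ->
  (forall s, 0 <= s <= h -> differentiable f (x + s *: v)) ->
  exists2 s, 0 < s < h & f (x + h *: v) - f x = h * 'D_v f (x + s *: v).
Proof.
move=> h0 df.
have D s : s \in `]0, h[ -> is_derive s 1 (fun t => f (x + t *: v)) ('D_v f (x + s *: v)).
  rewrite in_itv/= => /andP[s0 sh]; apply: is_derive_line; apply: df.
  by rewrite !ltW.
have [|s] := MVT h0 D.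
  apply: derivable_within_continuous => s; rewrite in_itv/= => sh.
  by have [] := is_derive_line (df s sh).
rewrite in_itv/= => sh; rewrite scale0r addr0 subr0 mulrC => E.
by exists s.
Qed.


Lemma derive_translate f x u w :
  'D_u (fun y => f (y + w)) x = 'D_u f (x + w).
Proof.
rewrite /derive.
suff -> : (fun k : R => k^-1 *: ((f \o shift (x + w)) (k *: u) - f (x + w))) =
   (fun k : R => k^-1 *: (((fun y => f (y + w)) \o shift x) (k *: u) - f (x + w))).
  by [].
by apply/funext => k /=; rewrite addrA.
Qed.

(** The mean value theorem twice: along u for y |-> f (y + h v) - f y, then
    along v for the derivative of f in the direction u. The left-hand side is
    symmetric in u and v, which is what makes Schwarz's theorem follow. *)
Lemma second_difference f x u v (h : R) : 0 < h ->
  (forall s t, 0 <= s <= h -> 0 <= t <= h ->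
     differentiable f (x + s *: u + t *: v)) ->
  (forall s t, 0 <= s <= h -> 0 <= t <= h ->
     differentiable ('D_u f) (x + s *: u + t *: v)) ->
  exists s t, [/\ 0 <= s <= h, 0 <= t <= h &
    f (x + h *: u + h *: v) - f (x + h *: u) - (f (x + h *: v) - f x) =
    h * (h * 'D_v ('D_u f) (x + s *: u + t *: v))].
Proof.
move=> h0 df ddf.
have h00 : 0 <= (0 : R) <= h by rewrite lexx ltW.
have hhh : 0 <= h <= h by rewrite ltW/=.
pose F y := f (y + h *: v) - f y.
have shift_diff y : differentiable f (y + h *: v) ->
    is_diff y (fun y => f (y + h *: v)) ('d f (y + h *: v)).
  move=> dy; have dsh : is_diff y (fun y => y + h *: v) (id + 0).
    exact: is_diffD.
  have -> : ('d f (y + h *: v) : _ -> _) = 'd f (y + h *: v) \o (id + 0 : _ -> _).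
    by apply/funext => w /=; congr ('d f _ _); exact/esym/addr0.
  by apply: is_diff_comp; exact: differentiableP.
have [s sh E] : exists2 s, 0 < s < h & F (x + h *: u) - F x = h * 'D_u F (x + s *: u).
  apply: MVT_line => // s sh; apply: differentiableB.
    by have [] := shift_diff _ (df _ _ sh hhh).
  by have := df _ _ sh h00; rewrite scale0r addr0.
have {}sh : 0 <= s <= h by case/andP: sh => ? ?; rewrite !ltW.
have dF : 'D_u F (x + s *: u) = 'D_u f (x + s *: u + h *: v) - 'D_u f (x + s *: u).
  have d1 := shift_diff _ (df _ _ sh hhh).
  have d0 : differentiable f (x + s *: u).
    by have := df _ _ sh h00; rewrite scale0r addr0.
  rewrite /F deriveB; [|exact: diff_derivable..].
  by rewrite derive_translate.
have [t th E'] := MVT_line h0 (fun t => ddf s t sh).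
exists s, t; split => //; first by case/andP: th => ? ?; rewrite !ltW.
by rewrite -E' -dF -E.
Qed.

Lemma continuous_near_dist f x (e : R) : 0 < e -> {for x, continuous f} ->
  \forall y \near x, `|f x - f y| < e.
Proof. by move=> e0 /cvgrPdist_lt/(_ e e0). Qed.

Lemma no_common_half_ball (a b c : R) :
  `|a - c| < `|a - b| / 2 -> `|b - c| < `|a - b| / 2 -> False.
Proof.
move=> A1; rewrite distrC => A2; have := ltrD A1 A2.
by rewrite -splitr -(subrKA c a (- b)) ltNge ler_normD.
Qed.

(** Schwarz's theorem. If the two mixed derivatives differed at x, then in a
    small ball around x each would stay within half of their distance from its
    own value at x, and they could not take a common value there; but the
    second difference of f, computed in the two orders, makes a value of one
    equal to a value of the other inside that ball. *)
Lemma partialC (U : set 'rV[R]_m) f x i j : open U -> U x -> C_on 2 U f ->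
  partial i (partial j f) x = partial j (partial i f) x.
Proof.
move=> oU Ux [df d2]; apply/eqP/negPn/negP => /eqP neq.
set a := partial i (partial j f) x; set b := partial j (partial i f) x.
pose e : R := `|a - b| / 2.
have e0 : 0 < e.
  apply: divr_gt0; last by rewrite ltr0n.
  by rewrite normr_gt0 subr_eq0; apply/eqP.
clear neq.
have [dj cj] := d2 j; have [di ci] := d2 i.
have na := continuous_near_dist e0 (cj i x Ux).
have nb := continuous_near_dist e0 (ci j x Ux).
have nU : \forall y \near x, U y by exact: open_nbhs_nbhs.
have [r r0 rP] : exists2 r : R, 0 < r & forall y, ball x r y -> U y /\
    (`|a - partial i (partial j f) y| < e /\ `|b - partial j (partial i f) y| < e).
  have /nbhs_ballP[r r0 rP] : nbhs x [set y | U y /\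
    (`|a - partial i (partial j f) y| < e /\ `|b - partial j (partial i f) y| < e)].
    exact: (filterI nU (filterI na nb)).
  by exists r; [exact: r0|exact: rP].
(* Two steps of length h in coordinate directions stay within distance 2 h < r. *)
pose h : R := r / 4.
have h0 : 0 < h by apply: divr_gt0; [exact: r0|rewrite ltr0n].
have inB s t k l : 0 <= s <= h -> 0 <= t <= h ->
    ball x r (x + s *: delta_mx 0 k + t *: delta_mx 0 l).
  have nd c : `|delta_mx 0 c : 'rV[R]_m| <= 1.
    rewrite [leLHS]/Num.Def.normr/= mx_normrE; apply: bigmax_le => // -[a1 c1] _.
    by rewrite mxE; case: (_ && _); rewrite ?normr1 ?normr0.
  move=> /andP[s0 sh] /andP[t0 th].
  rewrite -ball_normE/= -addrA opprD addrA subrr sub0r normrN.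
  rewrite (le_lt_trans (ler_normD _ _))// !normrZ !ger0_norm//.
  have p1 : s * `|delta_mx 0 k : 'rV[R]_m| <= h by rewrite -[leRHS]mulr1 ler_pM.
  have p2 : t * `|delta_mx 0 l : 'rV[R]_m| <= h by rewrite -[leRHS]mulr1 ler_pM.
  by rewrite (le_lt_trans (lerD p1 p2))// /h; lra.
have [s1 [t1 [s1h t1h E1]]] := second_difference h0
  (fun s t (sh : 0 <= s <= h) (th : 0 <= t <= h) => df _ (proj1 (rP _ (inB s t j i sh th))))
  (fun s t (sh : 0 <= s <= h) (th : 0 <= t <= h) => dj _ (proj1 (rP _ (inB s t j i sh th)))).
have [s2 [t2 [s2h t2h E2]]] := second_difference h0
  (fun s t (sh : 0 <= s <= h) (th : 0 <= t <= h) => df _ (proj1 (rP _ (inB s t i j sh th))))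
  (fun s t (sh : 0 <= s <= h) (th : 0 <= t <= h) => di _ (proj1 (rP _ (inB s t i j sh th)))).
have [_ [A1 _]] := rP _ (inB s1 t1 j i s1h t1h).
have [_ [_ A2]] := rP _ (inB s2 t2 i j s2h t2h).
have E : 'D_(delta_mx 0 i) ('D_(delta_mx 0 j) f)
      (x + s1 *: delta_mx 0 j + t1 *: delta_mx 0 i) =
    'D_(delta_mx 0 j) ('D_(delta_mx 0 i) f)
      (x + s2 *: delta_mx 0 i + t2 *: delta_mx 0 j).
  apply: (mulfI (lt0r_neq0 h0)); apply: (mulfI (lt0r_neq0 h0)).
  have swap (p q c d : R) : p - q - (c - d) = p - c - (q - d) by ring.
  apply: etrans (esym E1) _; apply: etrans E2.
  by rewrite (addrAC x); exact: swap.
have A1' : `|a - 'D_(delta_mx 0 j) ('D_(delta_mx 0 i) f)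
      (x + s2 *: delta_mx 0 i + t2 *: delta_mx 0 j)| < e.
  by rewrite -E; exact: A1.
exact: (no_common_half_ball A1' A2).
Qed.

End calculus2.

(** * Functions of class C^k on open sets *)

Section ck.
Context {R : realType} {m : nat} {V : normedModType R}.
Implicit Types (U : set 'rV[R]_m) (f g : 'rV[R]_m -> V).

(** The difference of the two functions vanishes near x, and is thus
    differentiable with zero differential. *)
Lemma near_eq_differentiable f g (x : 'rV[R]_m) :
  (\near x, f x = g x) -> differentiable f x -> differentiable g x.
Proof.
move=> fg df; suff dk : differentiable (g - f) x.
  by rewrite -[g](subrK f); exact: differentiableD.
have k0 : \forall y \near x, (g - f) y = 0.
  by apply: filterS fg => y fgy; apply/subr0_eq; rewrite subr0 -[LHS]/(g y - f y) fgy subrr.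
have kx : (g - f) x = 0 by exact: nbhs_singleton k0.
apply/diffP; apply: (@getPex _ (fun df : {linear 'rV[R]_m -> V} => continuous df /\
  forall y, (g - f) y = (g - f) (lim (nbhs x)) + df (y - lim (nbhs x))
                  +o_(y \near x) (y - lim (nbhs x)))).
exists (\0 : {linear _ -> _}); split; first exact: cst_continuous.
have H : (g - f) = cst ((g - f) (lim (nbhs x))) + \0 \o center (lim (nbhs x))
    +o_x (center (lim (nbhs x))).
  apply/eqaddoP => e e0; near=> y.
  have -> : (g - f - (cst ((g - f) (lim (nbhs x))) + \0 \o center (lim (nbhs x)))) y = 0.
    rewrite lim_id// kx -[LHS]/((g - f) y - (0 + 0)) addr0 subr0.
    by near: y.
  by rewrite normr0 mulr_ge0// ltW.
by move: H; rewrite funeqE.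
Unshelve. all: by end_near. Qed.

Lemma C_on_eq k U f g : open U -> (forall x, U x -> f x = g x) ->
  C_on k U f -> C_on k U g.
Proof.
move=> oU; elim: k f g => [|k IH] f g fg /=.
  move=> cf x Ux; have nfg : \forall y \near x, f y = g y.
    by apply: filterS (open_nbhs_nbhs (conj oU Ux)) => y; exact: fg.
  have cfx : f y @[y --> x] --> f x := cf x Ux.
  suff : g y @[y --> x] --> g x by [].
  rewrite -(fg x Ux); exact: cvg_trans (near_eq_cvg nfg) cfx.
have nfg x : U x -> \forall y \near x, f y = g y.
  by move=> Ux; apply: filterS (open_nbhs_nbhs (conj oU Ux)) => y; exact: fg.
move=> [df cf]; split=> [x Ux|i].
  by apply: near_eq_differentiable (df x Ux); exact: nfg.
by apply: IH (cf i) => x Ux; apply: near_eq_derive; exact: nfg.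
Qed.

End ck.

(** The directional derivatives of an entry are the entries of the directional
    derivatives, so that the induction on k goes through. *)
Lemma C_on_entry {R : realType} {m p q : nat} k (U : set 'rV[R]_m)
    (f : 'rV[R]_m -> 'M[R]_(p, q)) i j : open U ->
  C_on k U f -> C_on k U (fun x => f x i j).
Proof.
move=> oU; elim: k f => [|k IH] f /=.
  move=> cf x Ux; apply: (@continuous_comp _ _ _ f (fun M : 'M[R]_(p, q) => M i j)).
    exact: cf.
  exact: coord_continuous.
move=> [df cf]; split=> [x Ux|a].
  apply: (@differentiable_comp _ _ _ _ f (fun M : 'M[R]_(p, q) => M i j)); first exact: df.
  exact: differentiable_coord.
apply: C_on_eq (IH _ (cf a)) => // x Ux.
by rewrite derive_mx ?mxE//; apply: diff_derivable; exact: df.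
Qed.

Lemma continuous_at_sum {R : realType} {T : topologicalType} (I : finType)
    (F : I -> T -> R) (x : T) : (forall i, {for x, continuous (F i)}) ->
  {for x, continuous (fun y => \sum_i F i y)}.
Proof.
move=> cF; elim: (index_enum I) => [|k s IH].
  have -> : (fun y => \sum_(i <- [::]) F i y) = cst 0.
    by apply/funext => y; rewrite big_nil.
  exact: cst_continuous.
have -> : (fun y => \sum_(i <- k :: s) F i y) = F k + (fun y => \sum_(i <- s) F i y).
  by apply/funext => y; rewrite big_cons.
by apply: continuousD; [exact: cF|exact: IH].
Qed.

Section c1.
Context {R : realType} {m : nat}.
Implicit Types (U : set 'rV[R]_m) (f g : 'rV[R]_m -> R).

Lemma partial_cst i (c : R) (x : 'rV[R]_m) : partial i (fun=> c) x = 0.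
Proof. exact: derive_cst. Qed.

Lemma C1_cst U (c : R) : C_on 1 U (fun _ : 'rV[R]_m => c).
Proof.
split=> [x _|i x _]; first exact: differentiable_cst.
have -> : (fun x : 'rV[R]_m => 'D_(delta_mx 0 i) (fun=> c) x) = cst 0.
  by apply/funext => y; exact: derive_cst.
exact: cst_continuous.
Qed.

Lemma C1_continuous U f x : C_on 1 U f -> U x -> {for x, continuous f}.
Proof. by move=> [df _] Ux; apply: differentiable_continuous; exact: df. Qed.

Lemma partialD f g x i : differentiable f x -> differentiable g x ->
  partial i (fun y => f y + g y) x = partial i f x + partial i g x.
Proof. by move=> df dg; rewrite /partial deriveD//; exact: diff_derivable. Qed.

Lemma partialM f g x i : differentiable f x -> differentiable g x ->
  partial i (fun y => f y * g y) x = f x * partial i g x + g x * partial i f x.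
Proof. by move=> df dg; rewrite /partial deriveM//; exact: diff_derivable. Qed.

Lemma C1D U f g : open U -> C_on 1 U f -> C_on 1 U g ->
  C_on 1 U (fun x => f x + g x).
Proof.
move=> oU [df cf] [dg cg]; split=> [x Ux|i].
  by apply: differentiableD; [exact: df|exact: dg].
apply: (@C_on_eq _ _ _ 0 U (fun x => partial i f x + partial i g x)) => //.
  by move=> x Ux; rewrite -partialD//; [exact: df|exact: dg].
by move=> x Ux; apply: continuousD; [exact: cf|exact: cg].
Qed.

Lemma C1M U f g : open U -> C_on 1 U f -> C_on 1 U g ->
  C_on 1 U (fun x => f x * g x).
Proof.
move=> oU f1 g1; have [[df cf] [dg cg]] := (f1, g1); split=> [x Ux|i].
  by apply: differentiableM; [exact: df|exact: dg].
apply: (@C_on_eq _ _ _ 0 U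
    (fun x => f x * partial i g x + g x * partial i f x)) => //.
  by move=> x Ux; rewrite -partialM//; [exact: df|exact: dg].
move=> x Ux; apply: continuousD; apply: continuousM.
- exact: C1_continuous f1 Ux.
- exact: cg.
- exact: C1_continuous g1 Ux.
- exact: cf.
Qed.

Lemma C1_sum U (I : finType) (f : I -> 'rV[R]_m -> R) : open U ->
  (forall k, C_on 1 U (f k)) -> C_on 1 U (fun x => \sum_k f k x).
Proof.
move=> oU fC; elim: (index_enum I) => [|k s IH].
  apply: C_on_eq (C1_cst U 0) => // x _; by rewrite big_nil.
apply: C_on_eq (C1D oU (fC k) IH) => // x _; by rewrite big_cons.
Qed.

Lemma C1_prod U (I : finType) (P : pred I) (f : I -> 'rV[R]_m -> R) : open U ->
  (forall k, C_on 1 U (f k)) -> C_on 1 U (fun x => \prod_(k | P k) f k x).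
Proof.
move=> oU fC; elim: (index_enum I) => [|k s IH].
  apply: C_on_eq (C1_cst U 1) => // x _; by rewrite big_nil.
case Pk : (P k).
  apply: C_on_eq (C1M oU (fC k) IH) => // x _; by rewrite big_cons Pk.
by apply: C_on_eq IH => // x _; rewrite big_cons Pk.
Qed.

Lemma C1_det U n (G : 'rV[R]_m -> 'M[R]_n) : open U ->
  (forall a b, C_on 1 U (fun x => G x a b)) -> C_on 1 U (fun x => \det (G x)).
Proof.
move=> oU GC; apply: C1_sum => // s.
by apply: C1M => //; [exact: C1_cst|exact: C1_prod].
Qed.

Lemma partial_comp1 (h : R -> R) f x i (d : R) :
  is_derive (f x) 1 h d -> differentiable f x ->
  differentiable (fun y => h (f y)) x /\
  partial i (fun y => h (f y)) x = d * partial i f x.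
Proof.
move=> [dh hE] df; have dh' : differentiable h (f x) by exact/derivable1_diffP.
have dc : differentiable (fun y => h (f y)) x by exact: differentiable_comp.
split => //; rewrite /partial deriveE// (@diff_comp _ _ _ _ f h)//=.
by rewrite deriv1E// -derive1E in hE *; rewrite hE deriveE// mulrC.
Qed.

Lemma C1_comp1 U (h h' : R -> R) f : open U ->
  (forall x, U x -> is_derive (f x) 1 h (h' (f x))) ->
  (forall x, U x -> {for f x, continuous h'}) ->
  C_on 1 U f -> C_on 1 U (fun x => h (f x)).
Proof.
move=> oU dh ch f1; have [df cf] := f1; split=> [x Ux|i].
  apply: (@differentiable_comp _ _ _ _ f h); first exact: df.
  by apply/derivable1_diffP; have [] := dh x Ux.
apply: (@C_on_eq _ _ _ 0 U (fun x => h' (f x) * partial i f x)) => //.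
  by move=> x Ux; have [_ /esym] := partial_comp1 i (dh x Ux) (df x Ux).
move=> x Ux; apply: continuousM; last exact: cf.
by apply: continuous_comp; [exact: C1_continuous f1 Ux|exact: ch].
Qed.

End c1.

(** The partial derivatives of the composite are given by the chain rule, a
    sum of products of continuous functions. *)
Lemma C1_comp {R : realType} {m n : nat} (U : set 'rV[R]_m) (W : set 'rV[R]_n)
    (t : 'rV[R]_m -> 'rV[R]_n) (f : 'rV[R]_n -> R) : open U ->
  (forall x, U x -> W (t x)) -> C_on 1 U t -> C_on 1 W f ->
  C_on 1 U (fun x => f (t x)).
Proof.
move=> oU UW t1 [df cf]; have [dt ct] := t1; split=> [x Ux|i].
  apply: (@differentiable_comp _ _ _ _ t f); first exact: dt.
  exact/df/UW.
apply: (@C_on_eq _ _ _ 0 U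
    (fun x => \sum_a partial i (fun y => t y 0 a) x * partial a f (t x))) => //.
  move=> x Ux; rewrite -[RHS]/(partial i (fun y => f (t y)) x).
  rewrite partial_comp; [|exact: dt|exact/df/UW].
  by apply: eq_bigr => a _; rewrite jacobianE//; exact: dt.
move=> x Ux; have [_ tc] : C_on 1 U t by [].
apply: continuous_at_sum => a; apply: continuousM.
  have [_] := C_on_entry (k := 1) 0 a oU t1.
  by apply.
apply: (@continuous_comp _ _ _ t); first by apply: differentiable_continuous; exact: dt.
by apply: cf; exact: UW.
Qed.

(** * Derivatives of matrix-valued functions *)

Section determinant_derivative.
Context {R : realType} {m : nat}.
Implicit Types (x : 'rV[R]_m).

Lemma differentiable_prod (I : Type) (s : seq I) (P : pred I)
    (f : I -> 'rV[R]_m -> R) x : (forall k, differentiable (f k) x) ->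
  differentiable (fun y => \prod_(k <- s | P k) f k y) x.
Proof.
move=> df; elim: s => [|k s IH].
  have -> : (fun y => \prod_(k <- [::] | P k) f k y) = cst 1.
    by apply/funext => y; rewrite big_nil.
  exact: differentiable_cst.
case Pk : (P k).
  have -> : (fun y => \prod_(i <- k :: s | P i) f i y) =
      f k * (fun y => \prod_(i <- s | P i) f i y).
    by apply/funext => y; rewrite big_cons Pk.
  by apply: differentiableM; [exact: df|exact: IH].
have -> : (fun y => \prod_(i <- k :: s | P i) f i y) =
    (fun y => \prod_(i <- s | P i) f i y).
  by apply/funext => y; rewrite big_cons Pk.
exact: IH.
Qed.

Lemma differentiable_bigsum (I : Type) (s : seq I)
    (f : I -> 'rV[R]_m -> R) x : (forall k, differentiable (f k) x) ->
  differentiable (fun y => \sum_(k <- s) f k y) x.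
Proof.
move=> df; elim: s => [|k s IH].
  have -> : (fun y => \sum_(k <- [::]) f k y) = cst 0.
    by apply/funext => y; rewrite big_nil.
  exact: differentiable_cst.
have -> : (fun y => \sum_(i <- k :: s) f i y) =
    f k + (fun y => \sum_(i <- s) f i y).
  by apply/funext => y; rewrite big_cons.
by apply: differentiableD; [exact: df|exact: IH].
Qed.

Lemma partial_bigsum (I : Type) (s : seq I)
    (f : I -> 'rV[R]_m -> R) x j : (forall k, differentiable (f k) x) ->
  partial j (fun y => \sum_(k <- s) f k y) x = \sum_(k <- s) partial j (f k) x.
Proof.
move=> df; elim: s => [|k s IH].
  rewrite big_nil; have -> : (fun y => \sum_(k <- [::]) f k y) = cst 0.
    by apply/funext => y; rewrite big_nil.
  exact: derive_cst.
rewrite big_cons -IH -partialD; [|exact: df|exact: differentiable_bigsum].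
by congr (partial _ _ _); apply/funext => y; rewrite big_cons.
Qed.

(** The product rule for finitely many factors; duplicate-freeness lets the
    other factors be singled out by the condition i != k. *)
Lemma partial_bigprod (I : eqType) (s : seq I)
    (f : I -> 'rV[R]_m -> R) x j : uniq s -> (forall k, differentiable (f k) x) ->
  partial j (fun y => \prod_(k <- s) f k y) x =
  \sum_(k <- s) partial j (f k) x * \prod_(i <- s | i != k) f i x.
Proof.
move=> + df; elim: s => [_|k s IH /= /andP[ks us]].
  rewrite big_nil; have -> : (fun y => \prod_(k <- [::]) f k y) = cst 1.
    by apply/funext => y; rewrite big_nil.
  exact: derive_cst.
have -> : (fun y => \prod_(i <- k :: s) f i y) =
    (fun y => f k y * \prod_(i <- s) f i y).
  by apply/funext => y; rewrite big_cons.
rewrite partialM; [|exact: df|exact: differentiable_prod].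
rewrite big_cons big_cons eqxx /= addrC (IH us); congr (_ + _).
  rewrite mulrC; congr (_ * _); rewrite big_seq [RHS]big_seq_cond.
  apply: eq_bigl => i; case: eqVneq => [->|_]; last by rewrite andbT.
  by rewrite (negbTE ks).
rewrite mulr_sumr; apply: eq_big_seq => i si.
rewrite big_cons; case: eqVneq => [E|_]; first by rewrite E si in ks.
by rewrite mulrCA.
Qed.

Definition partial_mx p q j (F : 'rV[R]_m -> 'M[R]_(p, q)) x : 'M[R]_(p, q) :=
  \matrix_(a, b) partial j (fun y => F y a b) x.

Lemma partial_mxE p q j (F : 'rV[R]_m -> 'M[R]_(p, q)) x a b :
  partial_mx j F x a b = partial j (fun y => F y a b) x.
Proof. by rewrite mxE. Qed.

(** Jacobi's formula. Differentiating the Leibniz expansion gives the sum over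
    the rows i of the determinants in which row i is replaced by its
    derivative; expanding such a determinant along that row brings in the
    cofactors of G. *)
Lemma partial_det n (G : 'rV[R]_m -> 'M[R]_n) x j :
  (forall a b, differentiable (fun y => G y a b) x) ->
  partial j (fun y => \det (G y)) x = \tr (\adj (G x) *m partial_mx j G x).
Proof.
move=> dG; rewrite /determinant partial_bigsum; last first.
  move=> s; apply: differentiableM; first exact: differentiable_cst.
  by apply: differentiable_prod => i; exact: dG.
pose B i := \matrix_(k, b) if k == i then partial j (fun y => G y i b) x else G x k b.
transitivity (\sum_i \det (B i)).
  rewrite /determinant exchange_big /=; apply: eq_bigr => s _.
  rewrite partialM; [|exact: differentiable_cst|]; last first.
    by apply: differentiable_prod => i; exact: dG.
  rewrite [X in _ + _ * X](_ : _ = 0); last exact: derive_cst.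
  rewrite mulr0 addr0 partial_bigprod; [|exact: index_enum_uniq|by move=> i; exact: dG].
  rewrite mulr_sumr; apply: eq_bigr => i _; congr (_ * _).
  rewrite [RHS](bigD1 i)//= mxE eqxx; congr (_ * _).
  by apply: eq_bigr => k /negPf ki; rewrite mxE ki.
rewrite mxtrace_mulC /mxtrace; apply: eq_bigr => i _.
rewrite (expand_det_row _ i) mxE; apply: eq_bigr => b _.
rewrite !mxE eqxx; congr (_ * _); rewrite /cofactor; congr (_ * \det _).
apply/matrixP => a c; rewrite !mxE.
by case: eqVneq => // /eqP; rewrite eq_sym (negbTE (neq_lift _ _)).
Qed.

(** The logarithmic derivative of sqrt (det G), as partial_sqrt_det shows, in
    the form in which it arises as the trace of the Christoffel symbols. *)
Definition dlog_density n (G : 'rV[R]_m -> 'M[R]_n) j x : R :=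
  2^-1 * \tr (invmx (G x) *m partial_mx j G x).

Lemma partial_sqrt_det n (G : 'rV[R]_m -> 'M[R]_n) x j :
  (forall a b, differentiable (fun y => G y a b) x) -> 0 < \det (G x) ->
  differentiable (fun y => Num.sqrt (\det (G y))) x /\
  partial j (fun y => Num.sqrt (\det (G y))) x =
    Num.sqrt (\det (G x)) * dlog_density G j x.
Proof.
move=> dG detG.
have ddet : differentiable (fun y => \det (G y)) x.
  apply: differentiable_bigsum => s; apply: differentiableM.
    exact: differentiable_cst.
  by apply: differentiable_prod => i; exact: dG.
have ds : is_derive (\det (G x)) 1 Num.sqrt (2 * Num.sqrt (\det (G x)))^-1.
  exact: is_derive1_sqrt.
have [dsqrt ->] := partial_comp1 j ds ddet; split; first exact: dsqrt.
rewrite partial_det// /dlog_density /invmx unitmxE unitfE gt_eqF//.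
rewrite -scalemxAl mxtraceZ; set T := \tr _.
have s0 : Num.sqrt (\det (G x)) != 0 by rewrite gt_eqF// sqrtr_gt0.
set s := Num.sqrt (\det (G x)) in s0 *.
have -> : \det (G x) = s ^+ 2 by rewrite sqr_sqrtr// ltW.
by field.
Qed.

Lemma partial_mxM p q r (F : 'rV[R]_m -> 'M[R]_(p, q))
    (H : 'rV[R]_m -> 'M[R]_(q, r)) x j :
  (forall a b, differentiable (fun y => F y a b) x) ->
  (forall a b, differentiable (fun y => H y a b) x) ->
  partial_mx j (fun y => F y *m H y) x =
  partial_mx j F x *m H x + F x *m partial_mx j H x.
Proof.
move=> dF dH; apply/matrixP => a b; rewrite !mxE -big_split/=.
have -> : (fun y => (F y *m H y) a b) = (fun y => \sum_k F y a k * H y k b).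
  by apply/funext => y; rewrite mxE.
rewrite partial_bigsum; last by move=> k; apply: differentiableM; [exact: dF|exact: dH].
apply: eq_bigr => k _; rewrite partialM; [|exact: dF|exact: dH].
rewrite !partial_mxE [RHS]addrC; congr (_ + _); exact: mulrC.
Qed.

Lemma differentiable_mulmx p q r (F : 'rV[R]_m -> 'M[R]_(p, q))
    (H : 'rV[R]_m -> 'M[R]_(q, r)) x :
  (forall a b, differentiable (fun y => F y a b) x) ->
  (forall a b, differentiable (fun y => H y a b) x) ->
  forall a b, differentiable (fun y => (F y *m H y) a b) x.
Proof.
move=> dF dH a b.
have -> : (fun y => (F y *m H y) a b) = (fun y => \sum_k F y a k * H y k b).
  by apply/funext => y; rewrite mxE.
by apply: differentiable_bigsum => k; apply: differentiableM; [exact: dF|exact: dH].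
Qed.

Lemma partial_near_eq (f g : 'rV[R]_m -> R) x j :
  (\near x, f x = g x) -> partial j f x = partial j g x.
Proof. exact: near_eq_derive. Qed.

Lemma partial_mx_near_eq p q (F H : 'rV[R]_m -> 'M[R]_(p, q)) x j :
  (\near x, F x = H x) -> partial_mx j F x = partial_mx j H x.
Proof.
move=> FH; apply/matrixP => a b; rewrite !mxE; apply: partial_near_eq.
by apply: filterS FH => y ->.
Qed.

Lemma partial_mx_tr p q (F : 'rV[R]_m -> 'M[R]_(p, q)) x j :
  partial_mx j (fun y => (F y)^T) x = (partial_mx j F x)^T.
Proof.
apply/matrixP => a b; rewrite !mxE; congr (partial _ _ _).
by apply/funext => y; rewrite mxE.
Qed.

End determinant_derivative.

Lemma partial_mx_comp {R : realType} {m n : nat} p q (t : 'rV[R]_m -> 'rV[R]_n)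
    (F : 'rV[R]_n -> 'M[R]_(p, q)) x j : differentiable t x ->
  (forall a b, differentiable (fun y => F y a b) (t x)) ->
  partial_mx j (fun y => F (t y)) x = \sum_k 'J t x j k *: partial_mx k F (t x).
Proof.
move=> dt dF; apply/matrixP => a b.
rewrite mxE summxE (partial_comp (f := fun y => F y a b))//.
by apply: eq_bigr => k _; rewrite !mxE.
Qed.

(** * The divergence of a field with respect to a metric in coordinates *)

Section divergence.
Context {R : realType} {m : nat}.
Implicit Types (x : 'rV[R]_m) (G : 'rV[R]_m -> 'M[R]_m) (Y Z t : 'rV[R]_m -> 'rV[R]_m).

(** With G the metric in a chart, this is the trace of the covariant
    derivative of Y: the second sum is the contraction of the Christoffel
    symbols with Y. *)
Definition divergence G Y x : R :=
  \sum_k partial k (fun y => Y y 0 k) x + \sum_j dlog_density G j x * Y x 0 j.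

Lemma divergence_near_eq G Y Y' x : (\near x, Y x = Y' x) ->
  divergence G Y x = divergence G Y' x.
Proof.
move=> YY; congr (_ + _).
  apply: eq_bigr => k _; apply: partial_near_eq.
  by apply: filterS YY => y ->.
by apply: eq_bigr => k _; rewrite (nbhs_singleton YY).
Qed.

Lemma divergenceD G Y Z x :
  (forall k, differentiable (fun y => Y y 0 k) x) ->
  (forall k, differentiable (fun y => Z y 0 k) x) ->
  divergence G (fun y => Y y + Z y) x = divergence G Y x + divergence G Z x.
Proof.
move=> dY dZ; rewrite /divergence [RHS]addrACA; congr (_ + _); rewrite -big_split/=.
  apply: eq_bigr => k _; rewrite -partialD; [|exact: dY|exact: dZ].
  have -> // : (fun y => (Y y + Z y) 0 k) = (fun y => Y y 0 k + Z y 0 k).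
  by apply/funext => y; rewrite mxE.
by apply: eq_bigr => k _; rewrite mxE mulrDr.
Qed.

(** This is what makes the Riemannian divergence integrable by parts:
    multiplied by the volume density it becomes a Euclidean divergence. *)
Lemma divergence_sqrt_det G Y x :
  (forall a b, differentiable (fun y => G y a b) x) -> 0 < \det (G x) ->
  (forall k, differentiable (fun y => Y y 0 k) x) ->
  \sum_k partial k (fun y => Num.sqrt (\det (G y)) * Y y 0 k) x =
  Num.sqrt (\det (G x)) * divergence G Y x.
Proof.
move=> dG detG dY; rewrite /divergence mulrDr !mulr_sumr -big_split/=.
apply: eq_bigr => k _; have [ds dsE] := partial_sqrt_det k dG detG.
rewrite partialM; [|exact: ds|exact: dY].
rewrite dsE; congr (_ + _); rewrite mulrCA; congr (_ * _).
exact: mulrC.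
Qed.

(** Differentiating Y' (t y) = Y y J(y) produces in the first sum the extra
    term sum_i Y_i tr (J^-1 K_i), where K_i has the entries (d_j d_i t_a) in
    place (j, a); differentiating G = J G' J^T produces in the second sum the
    extra term sum_i Y_i tr (J^-1 d_i J), where d_i J has the entries d_i d_j
    t_a. They have opposite signs and agree by Schwarz's theorem. *)
Lemma divergence_change (U : set 'rV[R]_m) t G G' Y Y' x : open U -> U x ->
  C_on 2 U t -> 'J t x \in unitmx -> G' (t x) \in unitmx ->
  (forall y, U y -> G y = 'J t y *m G' (t y) *m ('J t y)^T) ->
  (forall y, U y -> Y' (t y) = Y y *m 'J t y) ->
  (forall a b, differentiable (fun y => G' y a b) (t x)) ->
  (forall k, differentiable (fun y => Y' y 0 k) (t x)) ->
  (forall k, differentiable (fun y => Y y 0 k) x) ->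
  divergence G Y x = divergence G' Y' (t x).
Proof.
move=> oU Ux t2 JU GU GE YE dG' dY' dY.
have nU : \forall y \near x, U y by exact: open_nbhs_nbhs.
have [dt _] := t2; have dtx := dt x Ux.
pose tc a := fun y => t y 0 a.
have tc2 a : C_on 2 U (tc a) by exact: C_on_entry t2.
have JE y i a : U y -> 'J t y i a = partial i (tc a) y.
  by move=> Uy; rewrite jacobianE//; exact: dt.
have dJ a b : differentiable (fun y => 'J t y a b) x.
  have [_ /(_ a) [d _]] := tc2 b.
  apply: near_eq_differentiable (d x Ux).
  by apply: filterS nU => y Uy; rewrite JE.
pose J := 'J t x; pose dJm j := partial_mx j (fun y => 'J t y) x.
have dJmE i j a : dJm i j a = partial i (partial j (tc a)) x.
  rewrite /dJm partial_mxE; apply: partial_near_eq.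
  by apply: filterS nU => y Uy; exact: JE.
(* This symmetry is where Schwarz's theorem enters. *)
have schwarz i j a : dJm i j a = dJm j i a.
  by apply: etrans (dJmE i j a) _; apply: etrans (esym (dJmE j i a));
     exact: (partialC i j oU Ux (tc2 a)).
have dcomp p (F : 'rV[R]_m -> 'M[R]_(p, m)) :
    (forall a b, differentiable (fun y => F y a b) (t x)) ->
    forall a b, differentiable (fun y => F (t y) a b) x.
  move=> dF a b; exact: (@differentiable_comp _ _ _ _ t (fun y => F y a b)).
have theta j : dlog_density G j x =
    \tr (invmx J *m dJm j) + \sum_a J j a * dlog_density G' a (t x).
  rewrite /dlog_density.
  have -> : partial_mx j G x =
      partial_mx j (fun y => 'J t y *m G' (t y) *m ('J t y)^T) x.
    by apply: partial_mx_near_eq; apply: filterS nU => y Uy; rewrite GE.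
  have dGt := dcomp _ _ dG'.
  have dJT a b : differentiable (fun y => ('J t y)^T a b) x.
    by apply: near_eq_differentiable (dJ b a); near=> y; rewrite [RHS]mxE.
  rewrite partial_mxM//; last exact: differentiable_mulmx.
  rewrite partial_mxM// partial_mx_tr -/J -/(dJm j) GE// -/J.
  rewrite partial_mx_comp//; set S := \sum_k _.
  have JTU : J^T \in unitmx by rewrite unitmx_tr.
  have GJU : J *m G' (t x) \in unitmx by rewrite unitmx_mul JU.
  have -> : invmx (J *m G' (t x) *m J^T) =
      invmx J^T *m invmx (G' (t x)) *m invmx J.
    apply: (can_inj (mulKmx (_ : J *m G' (t x) *m J^T \in unitmx))).
      by rewrite !unitmx_mul JU GU.
    rewrite mulmxV ?unitmx_mul ?JU ?GU ?JTU//.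
    by rewrite -!mulmxA (mulmxA J^T) mulmxV// mul1mx (mulmxA (G' _)) mulmxV// mul1mx mulmxV.
  rewrite mulmxDl mulmxDr mulmxDr !mxtraceD.
  have -> : \tr (invmx J^T *m invmx (G' (t x)) *m invmx J *m (dJm j *m G' (t x) *m J^T)) =
      \tr (invmx J *m dJm j).
    rewrite !mulmxA mxtrace_mulC !mulmxA mulmxV// mul1mx.
    by rewrite mxtrace_mulC !mulmxA mulmxV// mul1mx.
  have -> : \tr (invmx J^T *m invmx (G' (t x)) *m invmx J *m (J *m S *m J^T)) =
      \tr (invmx (G' (t x)) *m S).
    by rewrite !mulmxA mxtrace_mulC !mulmxA mulmxV// mul1mx mulmxKV.
  have -> : \tr (invmx J^T *m invmx (G' (t x)) *m invmx J *m (J *m G' (t x) *m (dJm j)^T)) =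
      \tr (invmx J *m dJm j).
    rewrite !mulmxA mulmxKV// mulmxKV// -mxtrace_tr trmx_mul trmxK trmx_inv trmxK.
    exact: mxtrace_mulC.
  rewrite /S mulmx_sumr linear_sum/=.
  have -> : \sum_i \tr (invmx (G' (t x)) *m (J j i *: partial_mx i G' (t x))) =
     \sum_i 2 * (J j i * (2^-1 * \tr (invmx (G' (t x)) *m partial_mx i G' (t x)))).
    by apply: eq_bigr => i _; rewrite -scalemxAr mxtraceZ; field.
  rewrite -mulr_sumr; set s := \sum_i _; set T := \tr _; by field.
have YJ : (\matrix_(b, a) partial b (fun y => Y' y 0 a) (t x)) =
    invmx J *m ((\matrix_(j, i) partial j (fun y => Y y 0 i) x) *m J +
       \matrix_(j, a) (Y x *m dJm j) 0 a).
  apply: (can_inj (mulKmx JU)); rewrite mulKVmx//.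
  apply/matrixP => j a; rewrite mxE.
  transitivity (partial_mx j (fun y => Y' (t y)) x 0 a).
    rewrite partial_mx_comp//; last by move=> a' b'; rewrite ord1.
    by rewrite summxE; apply: eq_bigr => k _; rewrite !mxE.
  rewrite (partial_mx_near_eq (H := fun y => Y y *m 'J t y)); last first.
    by apply: filterS nU => y Uy; rewrite YE.
  rewrite partial_mxM//; last by move=> a' b'; rewrite ord1.
  rewrite [LHS]mxE [RHS]mxE; congr (_ + _); last by rewrite [RHS]mxE.
  rewrite [LHS]mxE [RHS]mxE; apply: eq_bigr => k _; congr (_ * _).
  by rewrite [LHS]mxE [RHS]mxE.
have trY : \sum_a partial a (fun y => Y' y 0 a) (t x) =
    \sum_i partial i (fun y => Y y 0 i) x + \sum_i Y x 0 i * \tr (invmx J *m dJm i).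
  transitivity (\tr (\matrix_(b, a) partial b (fun y => Y' y 0 a) (t x))).
    by apply: eq_bigr => a _; rewrite mxE.
  rewrite YJ mulmxDr mxtraceD; congr (_ + _).
    rewrite mulmxA mxtrace_mulC !mulmxA mulmxV// mul1mx.
    by apply: eq_bigr => a _; rewrite mxE.
  have -> : \tr (invmx J *m (\matrix_(j, a) (Y x *m dJm j) 0 a)) =
      \sum_a \sum_j \sum_i Y x 0 i * (invmx J a j * dJm j i a).
    apply: eq_bigr => a _; rewrite mxE; apply: eq_bigr => j _; rewrite mxE mxE mulr_sumr.
    by apply: eq_bigr => i _; rewrite mulrCA.
  under eq_bigr do rewrite exchange_big /=.
  rewrite exchange_big/=; apply: eq_bigr => i _; rewrite mulr_sumr.
  apply: eq_bigr => a _.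
  have -> : (invmx J *m dJm i) a a = \sum_j invmx J a j * dJm i j a by rewrite mxE.
  rewrite mulr_sumr; apply: eq_bigr => j _; congr (_ * (_ * _)).
  exact: schwarz.
rewrite /divergence trY -addrA; congr (_ + _).
under eq_bigr do rewrite theta mulrDl.
rewrite big_split/=; congr (_ + _); first by apply: eq_bigr => i _; rewrite mulrC.
rewrite YE//; under [RHS]eq_bigr do rewrite mxE mulr_sumr.
rewrite exchange_big/=; apply: eq_bigr => j _; rewrite mulr_suml.
by apply: eq_bigr => a _; rewrite mulrC [in RHS]mulrC -mulrA.
Unshelve. all: by end_near. Qed.

End divergence.

(** * Positive definite matrices *)

Section posdef.
Context {R : realType} {m : nat}.
Implicit Types G : 'M[R]_m.

Definition posdef G := forall v : 'rV[R]_m, v != 0 -> 0 < (v *m G *m v^T) 0 0.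

Lemma posdef_unit G : posdef G -> G \in unitmx.
Proof.
move=> pG; rewrite unitmxE unitfE; apply/negP => /det0P[v v0 vG].
by have := pG v v0; rewrite vG mul0mx mxE ltxx.
Qed.

(** On the segment from 1 to G all matrices are positive definite, hence
    invertible, so that the determinant, a polynomial in the parameter with
    value 1 at 0, has no root in [0, 1] and stays positive. *)
Lemma posdef_det_gt0 G : posdef G -> 0 < \det G.
Proof.
move=> pG; rewrite ltNge; apply/negP => detG.
pose P : 'M[{poly R}]_m := map_mx polyC 1%:M + 'X *: map_mx polyC (G - 1%:M).
have PE s : (\det P).[s] = \det (1%:M + s *: (G - 1%:M)).
  rewrite -/(horner_eval s _) -det_map_mx; congr (\det _).
  by apply/matrixP => i j; rewrite !mxE /= /horner_eval !hornerE.
have [||s /andP[s0 s1] /rootP] := @poly_ivt R (- \det P) 0 1.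
- exact: ler01.
- rewrite !hornerN !PE scale0r addr0 det1 scale1r addrC subrK.
  by rewrite oppr_le0 ler01 oppr_ge0.
rewrite hornerN PE => /eqP; rewrite oppr_eq0 => /eqP dets.
suff : posdef (1%:M + s *: (G - 1%:M)).
  by move/posdef_unit; rewrite unitmxE dets unitr0.
move=> v v0.
have -> : 1%:M + s *: (G - 1%:M) = (1 - s) *: 1%:M + s *: G.
  by rewrite scalerBr scalerBl scale1r addrCA addrC [X in X + _]addrC.
rewrite mulmxDr mulmxDl -!scalemxAr -!scalemxAl mxE mxE [X in _ + X]mxE mulmx1.
have vv : 0 < (v *m v^T) 0 0.
  rewrite mxE; under eq_bigr do rewrite mxE -expr2.
  have [k vk] : exists k, v 0 k != 0.
    apply/existsP; apply: contraNT v0 => /existsPn v0; apply/eqP/rowP => k.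
    by rewrite mxE; apply/eqP; rewrite -[_ == _]negbK; exact: v0.
  rewrite (bigD1 k)//= ltr_pwDl ?sumr_ge0// ?exprn_even_gt0//.
  by move=> i _; exact: sqr_ge0.
have := pG v v0; set a := (v *m G *m _) 0 0 => a0.
have [->|sn0] := eqVneq s 0; first by rewrite subr0 mul1r mul0r addr0.
have sgt0 : 0 < s by rewrite lt_def sn0.
by rewrite ltr_wpDl ?mulr_gt0// mulr_ge0 ?subr_ge0// ltW.
Qed.

Lemma posdef_congr G (K : 'M[R]_m) : posdef G -> K \in unitmx ->
  posdef (K *m G *m K^T).
Proof.
move=> pG KU v v0; rewrite !mulmxA -mulmxA -trmx_mul.
apply: pG; apply: contraNneq v0 => vK.
by rewrite -(mulmxK KU v) vK mul0mx.
Qed.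

End posdef.


(** * Jacobians and transition maps *)

Lemma row_jacobian {R : realType} {m n : nat} (t : 'rV[R]_m -> 'rV[R]_n) x i :
  differentiable t x -> row i ('J t x) = 'D_(delta_mx 0 i) t x.
Proof. by move=> dt; rewrite rowE deriveEjacobian. Qed.

Lemma jacobian_comp {R : realType} {m n p : nat} (t : 'rV[R]_m -> 'rV[R]_n)
    (s : 'rV[R]_n -> 'rV[R]_p) x : differentiable t x -> differentiable s (t x) ->
  'J (s \o t) x = 'J t x *m 'J s (t x).
Proof.
move=> dt ds; apply/row_matrixP => i; rewrite row_jacobian; last exact: differentiable_comp.
rewrite [RHS]rowE deriveE; last exact: differentiable_comp.
rewrite (@diff_comp _ _ _ _ t s)//=.
by rewrite mulmxA -(deriveEjacobian _ dt) -(deriveEjacobian _ ds) !deriveE.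
Qed.

Lemma jacobian_near_eq {R : realType} {m n : nat} (s t : 'rV[R]_m -> 'rV[R]_n) x :
  differentiable s x -> (\near x, s x = t x) -> 'J s x = 'J t x.
Proof.
move=> ds st; have dt := near_eq_differentiable st ds.
apply/row_matrixP => i; apply: etrans (row_jacobian i ds) _.
by apply: etrans (esym (row_jacobian i dt)); exact: near_eq_derive.
Qed.

Lemma jacobian_id {R : realType} {m : nat} (x : 'rV[R]_m) : 'J id x = 1%:M.
Proof.
apply/row_matrixP => i; rewrite row_jacobian; last by [].
rewrite rowE mulmx1; exact: derive_id.
Qed.

Section charts.
Context {R : realType} {M : topologicalType} {m : nat}.
Implicit Types (c d e : chart R M m) (x y : 'rV[R]_m) (p : M).

Definition cimg c : set 'rV[R]_m := cfwd c @` cdom c.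

Lemma cimgP c x : cimg c x -> cdom c (cbwd c x) /\ cfwd c (cbwd c x) = x.
Proof. by move=> [p cp <-]; rewrite cfwdK. Qed.

Lemma cimg_fwd c p : cdom c p -> cimg c (cfwd c p).
Proof. by move=> cp; exists p. Qed.

Lemma overlapE c d : overlap c d = [set x | cimg c x /\ cdom d (cbwd c x)].
Proof.
apply/seteqP; split => [x [p [cp dp] <-]|x [[p cp <-]]] /=.
  by rewrite cfwdK//; split => //; exists p.
by rewrite cfwdK// => dp; exists p.
Qed.

Lemma near_cimg c x : cimg c x -> \forall y \near x, cimg c y.
Proof. by move=> cx; apply: open_nbhs_nbhs; split => //; exact: cimg_open. Qed.

Lemma near_cbwd c x (W : set M) : cimg c x -> open W -> W (cbwd c x) ->
  \forall y \near x, W (cbwd c y).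
Proof.
move=> cx oW Wx; have cc := cbwd_cont cx.
by apply: (cc W); exact: open_nbhs_nbhs.
Qed.

Lemma open_cimg_preimage c (W : set M) : open W ->
  open [set x | cimg c x /\ W (cbwd c x)].
Proof.
move=> oW; rewrite openE => x [cx dx]; apply: filterI; first exact: near_cimg.
exact: near_cbwd.
Qed.

Lemma open_overlap c d : open (overlap c d).
Proof. by rewrite overlapE; apply: open_cimg_preimage; exact: cdom_open. Qed.

Lemma overlap_fwd c d p : cdom c p -> cdom d p -> overlap c d (cfwd c p).
Proof. by move=> cp dp; exists p. Qed.

Lemma transition_fwd c d p : cdom c p -> transition c d (cfwd c p) = cfwd d p.
Proof. by move=> cp; rewrite /transition /= cfwdK. Qed.

Lemma overlap_transition c d x : overlap c d x -> overlap d c (transition c d x).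
Proof.
by move=> [p [cp dp] <-]; rewrite transition_fwd//; exact: overlap_fwd.
Qed.

Lemma near_overlap c d x : overlap c d x -> \forall y \near x, overlap c d y.
Proof. by move=> ox; apply: open_nbhs_nbhs; split => //; exact: open_overlap. Qed.

Lemma transition_differentiable c d x : compatible c d -> overlap c d x ->
  differentiable (transition c d) x.
Proof. by move=> [/(_ 1%N)[+ _] _]; apply. Qed.

Lemma compatibleC c d : compatible c d -> compatible d c.
Proof. by case. Qed.

(** The chain rule for the composite of the two transition maps, which is the
    identity near x. *)
Lemma jacobian_transition_inv c d x : compatible c d -> overlap c d x ->
  'J (transition c d) x *m 'J (transition d c) (transition c d x) = 1%:M.
Proof.
move=> cd ox.
have dt := transition_differentiable cd ox.
have ds := transition_differentiable (compatibleC cd) (overlap_transition ox).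
rewrite -jacobian_comp// -(jacobian_id x); apply: jacobian_near_eq.
  exact: differentiable_comp.
apply: filterS (near_overlap ox) => _ [p [cp dp] <-].
by rewrite /= !transition_fwd.
Qed.

Lemma jacobian_transition_unit c d x : compatible c d -> overlap c d x ->
  'J (transition c d) x \in unitmx.
Proof.
move=> cd ox; exact: (proj1 (mulmx1_unit (jacobian_transition_inv cd ox))).
Qed.

(** Near the point, passing from c to e directly and through d are the same
    map. *)
Lemma jacobian_transition_comp c d e p : compatible c d -> compatible d e ->
  cdom c p -> cdom d p -> cdom e p ->
  'J (transition c e) (cfwd c p) =
  'J (transition c d) (cfwd c p) *m 'J (transition d e) (cfwd d p).
Proof.
move=> cd de cp dp ep.
have dt := transition_differentiable cd (overlap_fwd cp dp).
have ds : differentiable (transition d e) (transition c d (cfwd c p)).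
  rewrite (transition_fwd d cp).
  exact: (transition_differentiable de (overlap_fwd dp ep)).
apply: (@etrans _ _ ('J (transition d e \o transition c d) (cfwd c p))).
  apply/esym/jacobian_near_eq; first exact: (differentiable_comp dt ds).
  apply: filterS (near_overlap (overlap_fwd cp dp)) => _ [q [cq dq] <-].
  by rewrite /= !transition_fwd.
by apply: etrans (jacobian_comp dt ds) _; rewrite (transition_fwd d cp).
Qed.

End charts.

(** * Fields and metrics in charts; the divergence as a trace *)

Section tangent.
Context {R : realType} {M : topologicalType} {m : nat}.
Variable S : smooth_structure R M m.
Implicit Types (c d : chart R M m) (x : 'rV[R]_m) (p : M)
  (X : M -> 'rV[R]_m) (g : M -> 'M[R]_m).

Lemma to_chart_at p : to_chart S (chart_at S p) p = 1%:M.
Proof.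
have cp := mem_chart_at S p; set c := chart_at S p in cp *.
have cc : compatible c c by apply: (@atlas_compatible _ _ _ S); exact: atlas_chart_at.
have op := overlap_fwd cp cp.
apply: etrans (jacobian_id (cfwd c p)).
apply: (jacobian_near_eq (transition_differentiable cc op)).
by apply: filterS (near_overlap op) => _ [q [cq _] <-]; rewrite transition_fwd.
Qed.

(** The chain rule through the chart at p, with which the tangent space at p
    is identified. *)
Lemma to_chart_compose c d p : compatible (chart_at S p) c -> compatible c d ->
  cdom c p -> cdom d p ->
  to_chart S d p = to_chart S c p *m 'J (transition c d) (cfwd c p).
Proof.
by move=> pc cd cp dp; apply: jacobian_transition_comp => //; exact: mem_chart_at.
Qed.

Lemma to_chart_unit c p : compatible (chart_at S p) c -> cdom c p ->
  to_chart S c p \in unitmx.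
Proof.
move=> pc cp; apply: (jacobian_transition_unit pc).
by apply: overlap_fwd => //; exact: mem_chart_at.
Qed.

Section two_charts.
Variables (c d : chart R M m).
Hypotheses (cS : atlas S c) (dS : atlas S d).

Let cd : compatible c d. Proof. exact: (@atlas_compatible _ _ _ S). Qed.
Let pc p : compatible (chart_at S p) c.
Proof. by apply: (@atlas_compatible _ _ _ S) => //; exact: atlas_chart_at. Qed.

Lemma vf_loc_transition X x : overlap c d x ->
  vf_loc S d X (transition c d x) = vf_loc S c X x *m 'J (transition c d) x.
Proof.
move=> [p [cp dp] <-]; rewrite /vf_loc (transition_fwd d cp) (cfwdK cp) (cfwdK dp).
apply: etrans (congr1 (mulmx (X p)) (to_chart_compose (pc p) cd cp dp)) _.
exact: mulmxA.
Qed.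

(** The components of the metric carry the inverse of to_chart on both sides,
    and the cocycle relation to_chart_compose leaves one Jacobian on each
    side. *)
Lemma metric_loc_transition g x : overlap c d x ->
  metric_loc S g c x = 'J (transition c d) x *m
    metric_loc S g d (transition c d x) *m ('J (transition c d) x)^T.
Proof.
move=> [p [cp dp] <-]; rewrite /metric_loc (transition_fwd d cp) (cfwdK cp) (cfwdK dp).
have U1 := to_chart_unit (pc p) cp.
have U2 := jacobian_transition_unit cd (overlap_fwd cp dp).
move: (to_chart_compose (pc p) cd cp dp) U1 U2.
move: (to_chart S d p) (to_chart S c p) ('J _ _) => T' T J -> U1 U2.
have -> : invmx (T *m J) = invmx J *m invmx T.
  apply: (can_inj (mulKmx (_ : T *m J \in unitmx))); first by rewrite unitmx_mul U1.
  rewrite mulmxV ?unitmx_mul ?U1//.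
  by rewrite -mulmxA (mulmxA J) (mulmxV U2) mul1mx (mulmxV U1).
rewrite trmx_mul !mulmxA (mulmxV U2) mul1mx -[RHS]mulmxA -trmx_mul (mulmxV U2).
by rewrite trmx1 mulmx1.
Qed.

End two_charts.

Lemma metric_loc_posdef g c x : riemannian_metric S g -> atlas S c ->
  cimg c x -> posdef (metric_loc S g c x).
Proof.
move=> [_ gpos _] cS cx; have [cp _] := cimgP cx.
apply: posdef_congr; first by move=> v v0; exact: gpos.
rewrite unitmx_inv; apply: to_chart_unit cp.
by apply: (@atlas_compatible _ _ _ S) => //; exact: atlas_chart_at.
Qed.

Lemma metric_loc_entry g c a b k : riemannian_metric S g -> atlas S c ->
  C_on k (cimg c) (fun x => metric_loc S g c x a b).
Proof.
move=> [_ _ gs] cS; apply: (C_on_entry (k := k)); first exact: cimg_open.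
exact: gs.
Qed.

(** Stated entry by entry in every chart of the atlas: this is all that the
    divergence theorem needs, and it is stable under multiplication by C1
    cut-off functions, which are not smooth. *)
Definition C1_vf X := forall c, atlas S c ->
  forall k, C_on 1 (cimg c) (fun x => vf_loc S c X x 0 k).

Lemma smooth_vf_C1 X : smooth_vf S [set: M] X -> C1_vf X.
Proof.
move=> sX c cS k; apply: (C_on_entry (k := 1)); first exact: cimg_open.
by have := sX c cS 1%N; rewrite setIT.
Qed.

(** The divergence is read in the chart that the tangent space at p is
    identified with, in the same way as the covariant derivative; see
    divg_chart for other charts. *)
Definition divg g X p : R :=
  divergence (metric_loc S g (chart_at S p)) (vf_loc S (chart_at S p) X)
    (cfwd (chart_at S p) p).

(** The defining chart of divg at a point varies with the point without any
    regularity; by divergence_change the value is the same in every chart, so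
    that around a given point one may work in a single one. *)
Lemma divg_chart g X c x : riemannian_metric S g -> C1_vf X -> atlas S c ->
  cimg c x ->
  divg g X (cbwd c x) = divergence (metric_loc S g c) (vf_loc S c X) x.
Proof.
move=> gS X1 cS cx; have [cp xE] := cimgP cx; set p := cbwd c x in cp xE *.
have dS : atlas S (chart_at S p) by exact: atlas_chart_at.
have dp := mem_chart_at S p; rewrite /divg.
move: (chart_at S p) dS dp => d dS dp.
have op := overlap_fwd dp cp.
have cd : compatible d c by exact: (@atlas_compatible _ _ _ S).
have E : transition d c (cfwd d p) = x by rewrite transition_fwd.
have cE : cimg c (transition d c (cfwd d p)) by rewrite E.
apply: etrans (_ : _ = divergence _ _ (transition d c (cfwd d p))) (congr1 _ E).
apply: (@divergence_change _ _ (overlap d c)).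
- exact: open_overlap.
- exact: op.
- exact: (proj1 cd 2%N).
- exact: jacobian_transition_unit cd op.
- exact: posdef_unit (metric_loc_posdef gS cS cE).
- by move=> y oy; exact: (metric_loc_transition dS cS g oy).
- by move=> y oy; exact: (vf_loc_transition dS cS X oy).
- by move=> a b; have [+ _] := metric_loc_entry a b 1 gS cS; apply.
- by move=> k; have [+ _] := X1 c cS k; apply.
- by move=> k; have [+ _] := X1 d dS k; apply; exact: cimg_fwd.
Qed.

(** Of the three derivatives of the metric in the Christoffel symbol, two
    cancel after contraction with the symmetric inverse metric. *)
Lemma trace_christoffel g c x j : (forall p, (g p)^T = g p) ->
  \sum_k christoffel S g c x k k j = dlog_density (metric_loc S g c) j x.
Proof.
move=> gT; rewrite /christoffel -mulr_sumr; congr (_ * _).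
have GT := metric_loc_sym S c _ gT.
have gE a b : (fun y => metric_loc S g c y a b) = (fun y => metric_loc S g c y b a).
  by apply/funext => y; rewrite -[in LHS]GT mxE.
have iT a b : invmx (metric_loc S g c x) a b = invmx (metric_loc S g c x) b a.
  by rewrite -[in LHS]GT -trmx_inv mxE.
set I := invmx _ in iT *.
transitivity (\sum_k \sum_l (I k l * partial j (fun y => metric_loc S g c y k l) x +
  (I k l * partial k (fun y => metric_loc S g c y j l) x -
   I k l * partial l (fun y => metric_loc S g c y j k) x))).
  apply: eq_bigr => k _; apply: eq_bigr => l _; rewrite (gE k j).
  set u := partial _ _ _; set v := partial _ _ _; set w := partial _ _ _; ring.
transitivity (\sum_k \sum_l I k l * partial j (fun y => metric_loc S g c y k l) x).
  under eq_bigr do rewrite big_split/=.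
  rewrite big_split/= -[RHS]addr0; congr (_ + _).
  under eq_bigr do rewrite sumrB.
  rewrite sumrB [X in _ - X]exchange_big/=; apply/eqP; rewrite subr_eq0; apply/eqP.
  by apply: eq_bigr => k _; apply: eq_bigr => l _; rewrite iT.
apply: eq_bigr => k _; rewrite mxE; apply: eq_bigr => l _.
by rewrite partial_mxE gE.
Qed.

Lemma trace_nabla g X p : (forall q, (g q)^T = g q) ->
  \tr (nabla S g X p) = divg g X p.
Proof.
move=> gT; rewrite /divg /divergence /mxtrace.
under eq_bigr do rewrite mxE.
rewrite big_split/=; congr (_ + _); rewrite exchange_big/=.
by apply: eq_bigr => j _; rewrite -mulr_suml trace_christoffel.
Qed.

End tangent.

(** * The trace in an adapted orthogonal splitting *)

Section adapted_trace.
Context {R : realType} {m : nat}.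
Implicit Types (G D T B : 'M[R]_m).

Lemma posdef_mx_eq0 G q (W : 'M[R]_(q, m)) : posdef G ->
  W *m G *m W^T = 0 -> W = 0.
Proof.
move=> pG WGW; apply/row_matrixP => i; rewrite row0; apply/eqP/negPn/negP => Wi.
have := pG _ Wi; rewrite [row i W]rowE trmx_mul !mulmxA -(mulmxA _ W) -(mulmxA _ (W *m G)).
by rewrite WGW mulmx0 mul0mx mxE ltxx.
Qed.

Lemma orth_complement G D : G^T = G -> posdef G ->
  (D :&: kermx (G *m D^T) = 0)%MS /\ (1%:M <= D + kermx (G *m D^T))%MS.
Proof.
move=> GT pG; set Dp := kermx _.
have D0 : (D :&: Dp = 0)%MS.
  have /submxP[X WE] := capmxSl D Dp; have /sub_kermxP W0 := capmxSr D Dp.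
  apply: (posdef_mx_eq0 pG); rewrite [X in X^T]WE trmx_mul.
  by rewrite mulmxA -(mulmxA _ G) W0 mul0mx.
split => //; rewrite sub1mx -col_leq_rank mxrank_disjoint_sum//.
rewrite /Dp mxrank_ker -(mxrank_tr (G *m D^T)) trmx_mul trmxK GT mxrankMfree.
  by rewrite subnKC// rank_leq_row.
by rewrite row_free_unit; exact: posdef_unit.
Qed.

(** The vector v - v P is orthogonal to D, so that pairing with a vector of D
    does not see the difference between v and v P. *)
Lemma orthogonal_projection_form G D q (E : 'M[R]_(q, m)) :
  G^T = G -> posdef G -> (E <= D)%MS ->
  proj_mx D (kermx (G *m D^T)) *m G *m E^T = G *m E^T.
Proof.
move=> GT pG /submxP[X ->]; rewrite trmx_mul.
have [_ D1] := orth_complement D GT pG; set Dp := kermx _ in D1 *.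
set P := proj_mx _ _.
have : (1%:M - 1%:M *m P <= Dp)%MS by exact: proj_mx_compl_sub.
rewrite mul1mx => /sub_kermxP/eqP.
rewrite mulmxBl mul1mx subr_eq0 => /eqP H.
by rewrite mulmxA -(mulmxA P) -H !mulmxA.
Qed.

(** Write E, N, Xi for bases of the three orthogonal pieces and K for the Gram
    matrix of E. The matrix Pi = G E^T K^-1 E + G N^T N + G Xi^T Xi fixes E, N
    and Xi, which span, so that it is 1; inserting it in tr (B Pi) gives the
    three partial traces, of which the last two vanish. The operator - B P
    preserves T, since its image lies in D and is orthogonal to N, and its
    matrix X in the basis E is obtained by pairing E (- B P) = X E with E. *)
Lemma tr_conjmx_adapted n r G B T D (N : 'rV[R]_m) (Xi : 'M[R]_(r, m)) :
  G^T = G -> posdef G ->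
  \rank D = n.+1 -> \rank T = n -> (T <= D)%MS -> (N <= D)%MS ->
  N *m G *m T^T = 0 -> (N *m G *m N^T) 0 0 = 1 ->
  (kermx (G *m D^T) == Xi)%MS -> Xi *m G *m Xi^T = 1%:M ->
  B *m G *m N^T = 0 -> \tr (Xi *m B *m G *m Xi^T) = 0 ->
  \tr (conjmx (row_base T) (- (B *m proj_mx D (kermx (G *m D^T))))) = - \tr B.
Proof.
move=> GT pG rD rT TD ND NT NN /eqmxP XiD XiXi BN BXi.
have [D0 D1] := orth_complement D GT pG; set Dp := kermx _ in XiD D0 D1 *.
set P := proj_mx D Dp.
have NN1 : N *m G *m N^T = 1%:M.
  by rewrite [LHS]mx11_scalar NN.
have symm q s (X : 'M[R]_(q, m)) (Y : 'M[R]_(s, m)) : X *m G *m Y^T = 0 -> Y *m G *m X^T = 0.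
  by move=> XY; have := congr1 trmx XY; rewrite !trmx_mul trmxK GT trmx0 mulmxA.
have PG q (E : 'M[R]_(q, m)) : (E <= D)%MS -> P *m G *m E^T = G *m E^T.
  exact: orthogonal_projection_form.
have PD q (W : 'M[R]_(q, m)) : (W *m P <= D)%MS by exact: proj_mx_sub.
rewrite -/P; clearbody P.
have XiG q (E : 'M[R]_(q, m)) : (E <= D)%MS -> Xi *m G *m E^T = 0.
  move=> /submxP[X ->]; have : (Xi <= Dp)%MS by rewrite XiD.
  by move=> /sub_kermxP H; rewrite trmx_mul mulmxA -(mulmxA Xi) H mul0mx.
pose E := row_base T.
have ET : (E <= T)%MS by rewrite eq_row_base.
have TE : (T <= E)%MS by rewrite eq_row_base.
have Efree : row_free E := row_base_free T.
rewrite -/E; clearbody E.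
have ED := submx_trans ET TD.
have NE : N *m G *m E^T = 0.
  by have /submxP[X ->] := ET; rewrite trmx_mul mulmxA NT mul0mx.
have EN := symm _ _ _ _ NE.
pose K := E *m G *m E^T.
have KU : K \in unitmx.
  rewrite -row_free_unit -kermx_eq0; apply/eqP.
  have kE : kermx K *m E = 0.
    apply: (posdef_mx_eq0 pG); rewrite trmx_mul !mulmxA -(mulmxA _ E) -(mulmxA _ (E *m G)).
    by rewrite -/K mulmx_ker mul0mx.
  by apply: (row_free_inj Efree); rewrite kE mul0mx.
have DTN : (D <= T + N)%MS.
  have sub : (T + N <= D)%MS by rewrite addsmx_sub TD.
  have TN0 : (T :&: N = 0)%MS.
    have /submxP[X WX] := capmxSl T N; have /submxP[Y WY] := capmxSr T N.
    apply: (posdef_mx_eq0 pG); rewrite [X in X^T]WX [X in X *m _ *m _]WY.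
    by rewrite trmx_mul mulmxA -!mulmxA (mulmxA G) (mulmxA N) (mulmxA N) NT !mul0mx mulmx0.
  have rN : \rank N = 1%N.
    apply/eqP; rewrite eqn_leq rank_leq_row lt0n mxrank_eq0.
    by apply/eqP => N0; move: NN; rewrite N0 !mul0mx mxE => /eqP; rewrite eq_sym oner_eq0.
  have := mxrank_leqif_sup sub; rewrite mxrank_disjoint_sum// rT rN addn1 rD.
  by move=> [_ <-].
pose Pi := G *m E^T *m invmx K *m E + G *m N^T *m N + G *m Xi^T *m Xi.
have Pi1 : Pi = 1%:M.
  apply/eqP; rewrite -subr_eq0; apply/eqP; rewrite -[LHS]mul1mx; apply/sub_kermxP.
  have ker q (W : 'M[R]_(q, m)) : W *m Pi = W -> (W <= kermx (Pi - 1%:M))%MS.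
    by move=> WP; apply/sub_kermxP; rewrite mulmxBr WP mulmx1 subrr.
  apply: (submx_trans D1); rewrite addsmx_sub; apply/andP; split; last first.
    rewrite XiD; apply: ker; rewrite /Pi !mulmxDr !mulmxA (XiG _ _ ED) (XiG _ _ ND) XiXi.
    by rewrite !mul0mx !add0r mul1mx.
  apply: (submx_trans DTN); rewrite addsmx_sub; apply/andP; split.
    apply: (submx_trans TE); apply: ker; rewrite /Pi !mulmxDr !mulmxA -/K mulmxV//.
    by rewrite mul1mx EN (symm _ _ _ _ (XiG _ _ ED)) !mul0mx !addr0.
  apply: ker; rewrite /Pi !mulmxDr !mulmxA NE NN1 (symm _ _ _ _ (XiG _ _ ND)).
  by rewrite !mul0mx add0r addr0 mul1mx.
have trB : \tr B = \tr (E *m B *m G *m E^T *m invmx K).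
  rewrite -{1}(mulmx1 B) -Pi1 /Pi !mulmxDr !mxtraceD.
  rewrite [X in _ + X + _](_ : _ = 0); last by rewrite !mulmxA BN mul0mx mxtrace0.
  rewrite [X in _ + X](_ : _ = 0); last by rewrite mulmxA mxtrace_mulC !mulmxA.
  by rewrite !addr0 mulmxA mxtrace_mulC !mulmxA.
pose A := - (B *m P).
have EA : (E *m A <= T + N)%MS.
  apply: submx_trans DTN; rewrite /A mulmxN eqmx_opp mulmxA; exact: PD.
(* The component V along N of E A vanishes, by pairing with N. *)
have [X EAX] : exists X, E *m A = X *m E.
  have /sub_addsmxP[[U V] /= EAE] := EA.
  have VN : V *m N = 0.
    have : E *m A *m G *m N^T = 0.
      by rewrite /A mulmxN !mulNmx -!mulmxA (mulmxA P) PG// (mulmxA B) BN mulmx0 oppr0.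
    rewrite EAE !mulmxDl -!mulmxA (mulmxA T) (mulmxA N) NN1 mulmx1.
    by rewrite (symm _ _ _ _ NT) mulmx0 add0r => ->; rewrite mul0mx.
  by have /submxP[Z TZ] := TE; exists (U *m Z); rewrite EAE VN addr0 -mulmxA -TZ.
rewrite -/A /conjmx EAX -mulmxA mulmxVp// mulmx1.
have -> : X = E *m A *m G *m E^T *m invmx K by rewrite EAX -(mulmxA X) -(mulmxA X (E *m G)) -/K mulmxK.
rewrite trB -linearN; congr (\tr _).
by rewrite /A mulmxN !mulNmx; congr (- _); rewrite -!mulmxA (mulmxA P) (mulmxA (P *m G)) PG// !mulmxA.
Qed.

End adapted_trace.

(** * Metric compatibility, and sigma1 as a divergence *)

Section levi_civita.
Context {R : realType} {M : topologicalType} {m : nat}.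
Variable S : smooth_structure R M m.
Implicit Types (c : chart R M m) (x : 'rV[R]_m) (p : M)
  (X Y : M -> 'rV[R]_m) (g : M -> 'M[R]_m).

Lemma smooth_vf_differentiable (U : set M) X p k : open U -> U p ->
  smooth_vf S U X ->
  differentiable (fun y => vf_loc S (chart_at S p) X y 0 k) (cfwd (chart_at S p) p).
Proof.
move=> oU Up sX; have cS := atlas_chart_at S p; have cp := mem_chart_at S p.
move: (chart_at S p) cS cp => c cS cp.
have oV : open (cfwd c @` (cdom c `&` U)).
  rewrite (_ : _ @` _ = [set x | cimg c x /\ U (cbwd c x)]).
    exact: open_cimg_preimage.
  apply/seteqP; split => [x [q [cq Uq] <-]|x [[q cq <-]]] /=.
    by rewrite cfwdK//; split => //; exists q.
  by rewrite cfwdK// => Uq; exists q.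
have [+ _] := C_on_entry (k := 1) 0 k oV (sX c cS 1%N).
by apply; exists p.
Qed.

(** The matrix of the connection form in the direction i, acting on row
    vectors: covariant differentiation is X |-> d_i X + X A_i. *)
Definition christoffel_mx g c x i : 'M[R]_m :=
  \matrix_(a, l) christoffel S g c x l i a.

Lemma row_nabla g X p i :
  let c := chart_at S p in let x := cfwd c p in
  row i (nabla S g X p) =
  partial_mx i (vf_loc S c X) x + vf_loc S c X x *m christoffel_mx g c x i.
Proof.
move=> c x; apply/rowP => k; rewrite mxE mxE [RHS]mxE partial_mxE; congr (_ + _).
rewrite [RHS]mxE; apply: eq_bigr => j _.
by rewrite [X in _ = _ * X]mxE mulrC.
Qed.

(** Metric compatibility in matrix form, from christoffel_metric. *)
Lemma partial_metric_loc g c x i : (forall q, (g q)^T = g q) ->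
  metric_loc S g c x \in unitmx ->
  partial_mx i (metric_loc S g c) x =
  christoffel_mx g c x i *m metric_loc S g c x +
  metric_loc S g c x *m (christoffel_mx g c x i)^T.
Proof.
move=> gT GU; apply/matrixP => a b; rewrite partial_mxE christoffel_metric//.
rewrite big_split [RHS]mxE /=; congr (_ + _).
  by rewrite [RHS]mxE; apply: eq_bigr => l _; rewrite [X in _ = X * _]mxE.
rewrite [RHS]mxE; apply: eq_bigr => l _.
by rewrite [X in _ = _ * X]mxE [X in _ = _ * X]mxE mulrC.
Qed.

(** Differentiate the constant function X G Y^T in the direction i. With d_i G
    = A_i G + G A_i^T, where A_i = christoffel_mx, the terms group into the
    covariant derivatives of X and of Y. *)
Lemma nabla_inner_cst g X Y p (k : R) : riemannian_metric S g ->
  let c := chart_at S p in let x := cfwd c p in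
  (forall a, differentiable (fun y => vf_loc S c X y 0 a) x) ->
  (forall a, differentiable (fun y => vf_loc S c Y y 0 a) x) ->
  (\forall q \near p, inner g q (X q) (Y q) = k) ->
  nabla S g X p *m g p *m (Y p)^T + nabla S g Y p *m g p *m (X p)^T = 0.
Proof.
move=> gS c x dX dY XYk; have [gT _ _] := gS.
have cS : atlas S c by exact: atlas_chart_at.
have cp : cdom c p by exact: mem_chart_at.
have cx : cimg c x by exact: cimg_fwd.
have px : cbwd c x = p by exact: cfwdK.
have tp : to_chart S c (cbwd c x) = 1%:M by rewrite px to_chart_at.
have Gx : metric_loc S g c x = g p.
  by rewrite /metric_loc tp invmx1 trmx1 mulmx1 mul1mx px.
have Xx Z : vf_loc S c Z x = Z p by rewrite /vf_loc tp mulmx1 px.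
pose Fm y := vf_loc S c X y *m metric_loc S g c y *m (vf_loc S c Y y)^T.
have Fk : \forall y \near x, Fm y = k%:M.
  have cc : cbwd c y @[y --> x] --> p by rewrite -px; exact: cbwd_cont.
  have nk := cc _ XYk.
  apply: filterS (filterI (near_cimg cx) nk) => y [cy yk].
  have [cq _] := cimgP cy.
  have TU : to_chart S c (cbwd c y) \in unitmx.
    apply: to_chart_unit cq; apply: (@atlas_compatible _ _ _ S) => //.
    exact: atlas_chart_at.
  rewrite [LHS]mx11_scalar; congr (_%:M); apply: etrans yk.
  rewrite /Fm /vf_loc /metric_loc /inner; congr (fun_of_matrix _ 0 0).
  move: (to_chart _ _ _) TU => T TU; rewrite trmx_mul !mulmxA (mulmxK TU).
  by rewrite -[X in X *m _](mulmxA _ (invmx T)^T) -trmx_mul (mulmxV TU) trmx1 mulmx1.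
have dG a b : differentiable (fun y => metric_loc S g c y a b) x.
  by have [+ _] := metric_loc_entry a b 1 gS cS; apply.
have dXm a b : differentiable (fun y => vf_loc S c X y a b) x by rewrite ord1; exact: dX.
have dYT a b : differentiable (fun y => (vf_loc S c Y y)^T a b) x.
  have -> : (fun y => (vf_loc S c Y y)^T a b) = (fun y => vf_loc S c Y y b a).
    by apply/funext => y; rewrite mxE.
  by rewrite ord1; exact: dY.
apply/row_matrixP => i.
have Fi : partial_mx i Fm x = 0.
  rewrite (partial_mx_near_eq i Fk); apply/matrixP => a b; rewrite partial_mxE [RHS]mxE.
  exact: derive_cst.
move: Fi; rewrite /Fm partial_mxM; [|exact: differentiable_mulmx|exact: dYT].
rewrite partial_mxM; [|exact: dXm|exact: dG].
have GU : metric_loc S g c x \in unitmx by exact: posdef_unit (metric_loc_posdef gS cS cx).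
rewrite partial_mx_tr (partial_metric_loc i gT GU) !Xx Gx.
have rowD (u v : 'M[R]_(m, 1)) : row i (u + v) = row i u + row i v.
  exact: raddfD.
move=> E; rewrite row0 rowD !row_mul !row_nabla -/c -/x !Xx; move: E.
move: (christoffel_mx _ _ _ _) (partial_mx i _ x) (partial_mx i _ x) => A dX' dY'.
move=> E; rewrite !mulmxDl; rewrite !mulmxDl !mulmxDr !mulmxDl in E.
have sw (u v : 'rV[R]_m) : u *m g p *m v^T = v *m g p *m u^T.
  rewrite [LHS]mx11_scalar [RHS]mx11_scalar; congr (_%:M).
  by rewrite -[in LHS](trmxK (u *m g p *m v^T)) [LHS]mxE !trmx_mul trmxK gT mulmxA.
rewrite -E -!addrA; congr (_ + _); rewrite !mulmxA; congr (_ + _).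
rewrite [LHS]addrC; congr (_ + _); last exact: (sw _ (X p)).
by rewrite (sw (Y p *m A)) trmx_mul !mulmxA.
Qed.

(** The matrix to_chart is invertible, and copid_mx n has rank m - n. *)
Lemma fol_tangent_rank n (F : foliation S n) p : (n <= m)%N ->
  \rank (fol_tangent F p) = n.
Proof.
move=> nm; rewrite /fol_tangent mxrank_ker.
have TU : to_chart S (fol_at F p) p \in unitmx.
  apply: to_chart_unit; last exact: mem_fol_at.
  apply: compatibleC; apply: (fol_compatible (fol_atlas_fol_at F p)).
  exact: atlas_chart_at.
rewrite eqmxMfull ?row_full_unit// rank_copid_mx//.
by rewrite subKn.
Qed.

(** The two identities differentiated here are <N, N> = 1, which makes nabla N
    orthogonal to N, and <N, xi_a> = 0 near p, which trades nabla N against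
    nabla xi_a in the trace over the orthogonal complement of D; that trace
    then becomes - <N, H> = 0. *)
Lemma sigma1_divg g (D : M -> 'M[R]_m) n (F : foliation S n) (N : M -> 'rV[R]_m) p :
  (n <= m)%N -> riemannian_metric S g -> smooth_distribution S n.+1 D ->
  (forall p, (fol_tangent F p <= D p)%MS) ->
  smooth_vf S [set: M] N -> (forall p, inner g p (N p) (N p) = 1) ->
  (forall p, (N p <= D p)%MS) ->
  (forall p, (N p <= orth g (fol_tangent F) p)%MS) ->
  mean_curvature_perp_at S g D p 0 ->
  sigma1 g D F N p = - divg S g N p.
Proof.
move=> nm gS [rD _] TD sN NN ND NT [U [r [xi [Up [oU sxi Dxi oxi] H0]]]].
have [gT gpos _] := gS; have pG : posdef (g p) by move=> v v0; exact: gpos.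
have dN k := @smooth_vf_differentiable _ _ p k openT I sN.
have dxi a k := @smooth_vf_differentiable _ _ p k oU Up (sxi a).
pose Xi := \matrix_(a < r) xi a p.
rewrite /sigma1 /shape_operator /orthoproj /orth -trace_nabla//.
have BN : nabla S g N p *m g p *m (N p)^T = 0.
  have nN : \forall q \near p, inner g q (N q) (N q) = 1 by apply: nearW => q; exact: NN.
  have := nabla_inner_cst gS dN dN nN.
  rewrite -mulr2n -scaler_nat => /eqP; rewrite scaler_eq0 pnatr_eq0 /= => /eqP; exact.
have Bxi a : nabla S g N p *m g p *m (xi a p)^T = - (nabla S g (xi a) p *m g p *m (N p)^T).
  have nxi : \forall q \near p, inner g q (N q) (xi a q) = 0.
    apply: filterS (open_nbhs_nbhs (conj oU Up)) => q Uq.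
    have /eqmxP Dq := Dxi q Uq.
    have xiq : (xi a q <= orth g D q)%MS.
      by rewrite Dq -(rowK (fun a => xi a q) a) row_sub.
    have /submxP[Z ->] := ND q; move/sub_kermxP: xiq => E.
    have DE : D q *m (g q *m (xi a q)^T) = (xi a q *m (g q *m (D q)^T))^T.
      by rewrite !trmx_mul trmxK gT mulmxA.
    by rewrite /inner -!mulmxA DE E trmx0 mulmx0 mxE.
  apply/eqP; rewrite -addr_eq0; apply/eqP.
  exact: (nabla_inner_cst gS dN (dxi a) nxi).
apply: (@tr_conjmx_adapted _ _ n r (g p) _ _ _ (N p) Xi) => //.
- exact: fol_tangent_rank.
- by have /sub_kermxP := NT p; rewrite mulmxA.
- exact: NN.
- exact: Dxi.
- apply/matrixP => a b; rewrite [RHS]mxE -(oxi p Up a b) /inner.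
  rewrite -[xi a p](rowK (fun a => xi a p) a) -[xi b p](rowK (fun a => xi a p) b) -/Xi.
  rewrite -row_mul tr_row; rewrite !mxE; apply: eq_bigr => k _.
  by rewrite !mxE.
- have -> : \tr (Xi *m nabla S g N p *m g p *m Xi^T) =
     \sum_a (xi a p *m (nabla S g N p *m g p *m (xi a p)^T)) 0 0.
    apply: eq_bigr => a _; rewrite -!mulmxA [LHS]mxE [RHS]mxE.
    apply: eq_bigr => k _; rewrite [X in X * _]mxE; congr (_ * _).
    rewrite !mulmxA [LHS]mxE [RHS]mxE; apply: eq_bigr => l _.
    by congr (_ * _); rewrite !mxE.
  under eq_bigr do rewrite Bxi.
  rewrite -summxE.
  have PGN : orthoproj g D p *m g p *m (N p)^T = g p *m (N p)^T.
    exact: orthogonal_projection_form.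
  move: (orthoproj g D p) H0 PGN => P H0 PGN.
  have -> : \sum_a xi a p *m - (nabla S g (xi a) p *m g p *m (N p)^T) =
     - ((\sum_a xi a p *m nabla S g (xi a) p *m P) *m g p *m (N p)^T).
    rewrite !mulmx_suml -sumrN; apply: eq_bigr => a _.
    by rewrite mulmxN -!mulmxA (mulmxA P) PGN.
  by rewrite -H0 !mul0mx oppr0 mxE.
Qed.

End levi_civita.

(** * Borel measurability *)

Section borel.
Context {R : realType}.

Lemma measurable_fun_opens d (T : measurableType d) (D : set T) (f : T -> R) :
  (forall O, open O -> measurable (D `&` f @^-1` O)) -> measurable_fun D f.
Proof.
move=> fO; apply: (measurability _ (RGenOpens.measurableE R)).
by move=> _ [_ [a [b ->]] <-]; apply: fO; exact: interval_open.
Qed.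

Lemma measurable_fun_borel d (T : measurableType d) (M : ptopologicalType)
    (f : T -> g_sigma_algebraType (@open M)) :
  (forall O : set M, open O -> measurable (f @^-1` O)) -> measurable_fun setT f.
Proof.
move=> fO; apply: (@measurability _ _ T (g_sigma_algebraType (@open M)) setT f (@open M)) => //.
move=> _ [B oB <-]; rewrite setTI; exact: fO.
Qed.

Lemma borel_open (M : ptopologicalType) (O : set M) : open O ->
  measurable (O : set (g_sigma_algebraType (@open M))).
Proof. by move=> oO; exact: sub_sigma_algebra. Qed.

Lemma borel_continuous_measurable (M : ptopologicalType) (f : M -> R) :
  continuous f -> measurable_fun [set: g_sigma_algebraType (@open M)] f.
Proof.
move=> /continuousP cf; apply: measurable_fun_opens => O oO.
by rewrite setTI; apply: borel_open; exact: cf.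
Qed.

Definition tuple_row m (t : m.-tuple R) : 'rV[R]_m := \row_i tnth t i.

Lemma row_ballP m (x y : 'rV[R]_m) (e : R) : 0 < e ->
  ball x e y <-> forall i, `|x 0 i - y 0 i| < e.
Proof.
move=> e0; split=> [[_ xy] i|xy]; first exact: xy.
by split => // i j; rewrite ord1; exact: xy.
Qed.

(** The product sigma-algebra on tuples contains the cubes, and an open set is
    the union of the countably many cubes with rational centre and radius
    1/(k+1) that it contains. *)
Lemma measurable_tuple_row_open m (O : set 'rV[R]_m) : open O ->
  measurable (@tuple_row m @^-1` O).
Proof.
move=> oO.
pose F (qk : 'rV[rat]_m * nat) := [set t : m.-tuple R |
  forall i, `|ratr (qk.1 0 i) - tnth t i| < qk.2.+1%:R^-1].
have mF qk : measurable (F qk).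
  have -> : F qk = \bigcap_(i in [set: 'I_m])
      ((fun t : m.-tuple R => tnth t i) @^-1` ball (ratr (qk.1 0 i) : R) qk.2.+1%:R^-1).
    by apply/seteqP; split => t Ft i; [move=> _|]; exact: Ft.
  apply: fin_bigcap_measurable; first exact: finite_finset.
  move=> i _; rewrite -[X in measurable X]setTI.
  apply: measurable_tnth => //.
  by apply: open_measurable; exact: ball_open.
pose P (qk : 'rV[rat]_m * nat) := forall y : 'rV[R]_m,
  (forall i, `|ratr (qk.1 0 i) - y 0 i| < qk.2.+1%:R^-1) -> O y.
have -> : @tuple_row m @^-1` O = \bigcup_k
    (if unpickle k is Some qk then if `[< P qk >] then F qk else set0 else set0).
  apply/seteqP; split => [t Ot|t [k _]]; last first.
    case: (unpickle k) => // qk; case: asboolP => // Pqk Fqk.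
    by apply: Pqk => i; rewrite mxE; exact: Fqk.
  have /nbhs_ballP[e /= e0 eO] : nbhs (tuple_row t) O by exact: open_nbhs_nbhs.
  have e20 : 0 < e / 2 by rewrite divr_gt0.
  have [k ke] : exists k : nat, k.+1%:R^-1 < e / 2.
    have := near_infty_natSinv_lt (PosNum e20) => /filter_ex[k ke].
    by exists k.
  have k0 : 0 < k.+1%:R^-1 :> R by rewrite invr_gt0.
  have qP i : exists q : rat, `|ratr q - tnth t i| < k.+1%:R^-1.
    have [|q] := @rat_in_itvoo R (tnth t i - k.+1%:R^-1) (tnth t i + k.+1%:R^-1).
      by rewrite ltrD2l gtrN.
    rewrite in_itv/= => qi; exists q; by rewrite ltr_distl.
  pose q : 'rV[rat]_m := \row_i sval (cid (qP i)).
  have qE i : `|ratr (q 0 i) - tnth t i| < k.+1%:R^-1.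
    by rewrite mxE; case: cid.
  exists (pickle (q, k)) => //; rewrite pickleK.
  rewrite asboolT//= => y qy; apply: eO; apply/row_ballP => // i.
  rewrite mxE -(subrKA (ratr (q 0 i))) (le_lt_trans (ler_normD _ _))//.
  rewrite (splitr e) ltrD//; first by rewrite distrC (lt_trans (qE i)).
  by rewrite (lt_trans (qy i)).
apply: bigcupT_measurable => k; case: (unpickle k) => // qk.
by case: asboolP.
Qed.

Lemma measurable_tuple_row_fun m (U : set 'rV[R]_m) (f : 'rV[R]_m -> R) : open U ->
  (forall x, U x -> {for x, continuous f}) ->
  measurable_fun (@tuple_row m @^-1` U) (f \o @tuple_row m).
Proof.
move=> oU cf; apply: measurable_fun_opens => O oO.
rewrite (_ : _ `&` _ = @tuple_row m @^-1` (U `&` f @^-1` O)) //.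
apply: measurable_tuple_row_open; rewrite openE => x [Ux Ox].
apply: filterI; first exact: open_nbhs_nbhs.
by apply: (cf x Ux); exact: open_nbhs_nbhs.
Qed.

End borel.

(** * Integration against a measure given by a density *)

Section density.
Local Open Scope ereal_scope.
Context d1 d2 (X : measurableType d1) (Y : measurableType d2) (R : realType).
Variables (mu : {measure set X -> \bar R}) (nu : {measure set Y -> \bar R}).
Variables (phi : X -> Y) (h : X -> R) (E : set Y).
Hypotheses (mphi : measurable_fun setT phi) (mh : measurable_fun setT h).
Hypotheses (h0 : forall x, (0 <= h x)%R) (mE : measurable E).
Hypothesis nuE : forall A, measurable A -> A `<=` E ->
  nu A = \int[mu]_(x in phi @^-1` A) (h x)%:E.

Let mpre A : measurable A -> measurable (phi @^-1` A).
Proof. by move=> mA; rewrite -[X in measurable X]setTI; exact: mphi. Qed.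

Let hE0 x : 0 <= (h x)%:E. Proof. by rewrite lee_fin. Qed.

Import HBNNSimple.

(** The hypothesis nuE is the case of indicator functions; it extends to
    simple functions by linearity and to nonnegative functions by monotone
    convergence on both sides. *)
Lemma ge0_integral_density (f : Y -> \bar R) : measurable_fun E f ->
  (forall y, 0 <= f y) ->
  \int[nu]_(y in E) f y = \int[mu]_(x in phi @^-1` E) (f (phi x) * (h x)%:E).
Proof.
move=> mf f0.
pose f_ := nnsfun_approx mE mf.
have mhE D : measurable_fun D (EFin \o h) by apply/measurable_EFinP/measurable_funTS.
have mfphi n : measurable_fun setT (f_ n \o phi).
  by apply: measurableT_comp => //; exact: measurable_funP.
transitivity (limn (fun n => \int[nu]_(x in E) (f_ n x)%:E)).
  rewrite -monotone_convergence//.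
  - apply: eq_integral => y /[!inE] yE; apply/esym/cvg_lim => //.
    exact: cvg_nnsfun_approx.
  - by move=> n; exact/measurable_EFinP/measurable_funTS.
  - by move=> n y _; rewrite lee_fin.
  - by move=> y _ m n mn; rewrite lee_fin; exact/lefP/nd_nnsfun_approx.
rewrite [X in limn X](_ : _ =
    (fun n => \int[mu]_(x in phi @^-1` E) ((f_ n (phi x))%:E * (h x)%:E))).
  rewrite -monotone_convergence//; last 4 first.
    - exact: mpre.
    - move=> n; apply: emeasurable_funM => //.
      by apply/measurable_EFinP; apply: measurable_funTS; exact: mfphi.
    - by move=> n x _; rewrite mule_ge0// lee_fin.
    - by move=> x _ m n mn; rewrite lee_wpmul2r// lee_fin; exact/lefP/nd_nnsfun_approx.
  apply: eq_integral => x /[!inE] xE; apply/cvg_lim => //.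
  by apply: cvgeZr => //; exact: cvg_nnsfun_approx.
apply/funext => n.
transitivity (\sum_(k \in range (f_ n)) (k%:E * nu (E `&` f_ n @^-1` [set k]))).
  under eq_integral do rewrite fimfunE -fsumEFin//.
  rewrite ge0_integral_fsum//; last 2 first.
  - move=> y; apply/measurable_EFinP; exact: measurable_funM.
  - by move=> y x _; rewrite nnfun_muleindic_ge0.
  apply: eq_fsbigr => r _; rewrite integralZl_indic_nnsfun//.
  by rewrite integral_indic// setIC.
transitivity (\sum_(k \in range (f_ n))
    \int[mu]_(x in phi @^-1` E) ((k * \1_(f_ n @^-1` [set k]) (phi x))%:E * (h x)%:E)); last first.
  rewrite -ge0_integral_fsum//; last 3 first.
  - exact: mpre.
  - move=> y; apply: emeasurable_funM => //; apply/measurable_EFinP/measurable_funTS.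
    apply: measurable_funM => //.
    rewrite -[fun x => _]/((\1_(f_ n @^-1` [set y]) : Y -> R) \o phi).
    by apply: measurableT_comp => //; exact: measurable_indic.
  - by move=> y x _; rewrite mule_ge0// nnfun_muleindic_ge0.
  apply: eq_integral => x _; rewrite [X in X%:E * _]fimfunE -fsumEFin//.
  by rewrite ge0_mule_fsuml// => k; exact: nnfun_muleindic_ge0.
apply: eq_fsbigr => r rf; rewrite nuE; last 2 first.
- exact: measurableI.
- by move=> y [].
have r0 : (0 <= r)%R by move: rf; rewrite inE => -[y _ <-].
have mI : measurable (phi @^-1` E `&` phi @^-1` (f_ n @^-1` [set r])).
  by apply: measurableI; exact: mpre.
rewrite preimage_setI -ge0_integralZl//.
rewrite integral_mkcondr; apply: eq_integral => x xE.
rewrite patchE; case: ifPn => xr.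
  by rewrite indicE mem_set ?mulr1 ?EFinM//; move: xr; rewrite inE.
rewrite indicE memNset ?mulr0 ?mul0e//.
by move=> H; move/negP : xr; apply; rewrite inE.
Qed.

(** The integral is by definition the difference of the integrals of the
    positive and negative parts, and multiplication by the nonnegative h
    commutes with taking these parts. *)
Lemma integral_density (f : Y -> R) : measurable_fun E f ->
  \int[nu]_(y in E) (f y)%:E = \int[mu]_(x in phi @^-1` E) (f (phi x) * h x)%:E.
Proof.
move=> mf; rewrite integralE [RHS]integralE.
congr (_ - _).
  rewrite ge0_integral_density//; last first.
    exact/measurable_funepos/measurable_EFinP.
  apply: eq_integral => x _; rewrite !funeposE -!EFin_max -EFinM; congr (_%:E).
  by rewrite maxr_pMl// mul0r.
rewrite ge0_integral_density//; last first.
  exact/measurable_funeneg/measurable_EFinP.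
apply: eq_integral => x _; rewrite !funenegE -!EFinN -!EFin_max -EFinM; congr (_%:E).
by rewrite maxr_pMl// mul0r mulNr.
Qed.

End density.

(** * Partial derivatives integrate to zero in R^n *)

Section integrable_support.
Local Open Scope ereal_scope.
Context d (T : measurableType d) (R : realType).
Variable mu : {measure set T -> \bar R}.

Lemma integrable_bounded_support (B : set T) (g : T -> R) (K : R) :
  measurable B -> mu B < +oo -> measurable_fun setT g ->
  (forall t, (`|g t| <= K)%R) -> (forall t, ~ B t -> g t = 0%R) ->
  mu.-integrable setT (EFin \o g).
Proof.
move=> mB Boo mg gK g0.
have BE : (EFin \o g) = (EFin \o g) \_ B.
  apply/funext => t; rewrite patchE; case: ifPn => //= /negP tB.
  by rewrite g0// => Bt; apply: tB; rewrite inE.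
rewrite BE; apply/(integrable_mkcond _ mB).
apply: measurable_bounded_integrable => //; first exact: measurable_funTS.
exists K; split; first exact: num_real.
by move=> x Kx t _ /=; rewrite (le_trans (gK t))// ltW.
Qed.

End integrable_support.

Section euclid.
Context {R : realType}.

Definition box n (a : n.-tuple R) (r : R) : set (n.-tuple R) :=
  [set t | forall i, `|tnth a i - tnth t i| <= r].

Lemma measurable_box n (a : n.-tuple R) r : measurable (box a r).
Proof.
have -> : box a r = \bigcap_(i in [set: 'I_n])
    ((fun t : n.-tuple R => tnth t i) @^-1` `[tnth a i - r, tnth a i + r]%classic).
  apply/seteqP; split => t at_ i; last first.
    by have := at_ i I; rewrite /= in_itv/= -ler_distl distrC.
  by move=> _; rewrite /= in_itv/= -ler_distl distrC; exact: at_.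
apply: fin_bigcap_measurable; first exact: finite_finset.
move=> i _; rewrite -[X in measurable X]setTI.
by apply: measurable_tnth.
Qed.

Lemma tuple_cons_box n (a : n.+1.-tuple R) r :
  @tuple_cons R n @^-1` box a r =
  `[thead a - r, thead a + r]%classic `*` box [tuple of behead a] r.
Proof.
case/tupleP: a => x a; rewrite theadE.
have -> : [tuple of behead [tuple of x :: a]] = a by exact: val_inj.
apply/seteqP; split => -[y t] /=.
  move=> H; split => /=.
    by have := H ord0; rewrite !tnth0 in_itv/= -ler_distl distrC.
  by move=> i; have := H (lift ord0 i); rewrite !tnthS.
move=> [/=]; rewrite in_itv/= -ler_distl distrC => yr H i.
case: (unliftP ord0 i) => [j ->|->]; last by rewrite !tnth0.
by have := H j; rewrite !tnthS.
Qed.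

Lemma lebesgue_tuple_box n (a : n.-tuple R) r :
  (lebesgue_tuple R n (box a r) < +oo)%E.
Proof.
elim: n a => [|n IH] a /=.
  by rewrite /dirac/= indicE; case: (_ \in _); rewrite ltry.
rewrite /lebesgue_cons /pushforward tuple_cons_box product_measure1E//; last first.
  exact: measurable_box.
apply: lte_mul_pinfty => //.
by rewrite ge0_fin_numE//= lebesgue_measure_itv/=; case: ifP => _; rewrite ltry.
Qed.

Definition set_coord n (i : 'I_n) (s : R) (t : n.-tuple R) : n.-tuple R :=
  [tuple if j == i then s else tnth t j | j < n].

Lemma set_coord0 n s x (t : n.-tuple R) :
  set_coord ord0 s (tuple_cons (x, t)) = tuple_cons (s, t).
Proof.
apply: eq_from_tnth => i; rewrite tnth_mktuple.
case: (unliftP ord0 i) => [j ->|->]; last by rewrite eqxx tnth0.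
by rewrite eq_sym (negbTE (neq_lift _ _)) !tnthS.
Qed.

Lemma set_coordS n (j : 'I_n) s x (t : n.-tuple R) :
  set_coord (lift ord0 j) s (tuple_cons (x, t)) = tuple_cons (x, set_coord j s t).
Proof.
apply: eq_from_tnth => i; rewrite tnth_mktuple.
case: (unliftP ord0 i) => [k ->|->]; last by rewrite (negbTE (neq_lift _ _)) !tnth0.
by rewrite (inj_eq lift_inj) !tnthS tnth_mktuple.
Qed.

(** The fundamental theorem of calculus on an interval slightly larger than
    the support. *)
Lemma integral_derive_compact (f f' : R -> R) (a r : R) : 0 <= r ->
  (forall s : R, is_derive s 1 f (f' s)) -> continuous f' ->
  (forall s, r < `|a - s| -> f s = 0 /\ f' s = 0) ->
  (\int[lebesgue_measure]_s (f' s)%:E = 0)%E.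
Proof.
move=> r0 df cf' f0.
have lo : r < `|a - (a - (r + 1))| by rewrite opprB addrC subrK ger0_norm; lra.
have hi : r < `|a - (a + (r + 1))|.
  by rewrite opprD addrA subrr sub0r normrN ger0_norm; lra.
have ab : a - (r + 1) < a + (r + 1) by lra.
have cf : continuous f.
  by move=> s; apply: differentiable_continuous; apply/derivable1_diffP; have [] := df s.
have E : (EFin \o f') = (EFin \o f') \_ `[a - (r + 1), a + (r + 1)].
  apply/funext => s; rewrite patchE; case: ifPn => //=.
  rewrite notin_setE/= in_itv/= => /negP sn; have [] := f0 s; last by move=> _ ->.
  rewrite ltNge; apply: contra sn; rewrite distrC ler_distl => /andP[? ?].
  by apply/andP; split; lra.
transitivity (\int[lebesgue_measure]_(s in `[(a - (r + 1))%R, (a + (r + 1))%R]) (f' s)%:E)%E.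
  by rewrite [RHS]integral_mkcond -E.
rewrite (@continuous_FTC2 _ _ f)//.
- by have [-> _] := f0 _ lo; have [-> _] := f0 _ hi; rewrite subee.
- exact: continuous_subspaceT.
- split; first by move=> s _; have [] := df s.
    by apply: cvg_at_right_filter; exact: cf.
  by apply: cvg_at_left_filter; exact: cf.
- by move=> s _; rewrite derive1E; have [] := df s.
Qed.

(** Induction on the dimension with Fubini's theorem: if i is the first
    coordinate, integrate first over it; otherwise integrate first over the
    remaining ones, where the induction hypothesis applies. The support in a
    cube and the bound K give the integrability that Fubini needs, and are
    inherited by sections. *)
Lemma integral_partial_tuple n (i : 'I_n) (f f' : n.-tuple R -> R)
    (a : n.-tuple R) (r K : R) : 0 <= r ->
  measurable_fun setT f' -> (forall t, `|f' t| <= K) ->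
  (forall t, ~ box a r t -> f t = 0 /\ f' t = 0) ->
  (forall t (s : R), is_derive s 1 (fun u => f (set_coord i u t)) (f' (set_coord i s t))) ->
  (forall t, continuous (fun u => f' (set_coord i u t))) ->
  (\int[lebesgue_tuple R n]_t (f' t)%:E = 0)%E.
Proof.
move=> r0; elim: n i f f' a => [[]//|n IH] i f f' a mf' fK f0 df cf'.
(* The same product type, but with the measurable structure on R that
   lebesgue_measure is defined on. *)
pose T := (measurableTypeR R * n.-tuple R)%type.
have mt : measurable_fun [set: T] (@tuple_cons R n : T -> _).
  exact: (@measurable_tuple_cons R n).
have mcons : measurable_fun [set: T] (f' \o (@tuple_cons R n : T -> _)).
  exact: measurableT_comp mf' mt.
have mE : measurable_fun setT (EFin \o f') by exact/measurable_EFinP.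
have icons : (@lebesgue_measure R \x lebesgue_tuple R n)%E.-integrable [set: T]
    (EFin \o (f' \o (@tuple_cons R n : T -> _))).
  have mB : measurable ((@tuple_cons R n : T -> _) @^-1` box a r).
    rewrite -[X in measurable X]setTI; apply: mt => //.
    exact: measurable_box.
  apply: (integrable_bounded_support (K := K) mB) => //.
  - exact: (lebesgue_tuple_box a r).
  - by move=> xt; exact: fK.
  - by move=> xt /f0[].
apply: etrans (integral_pushforward (D := setT) mt mE icons measurableT) _.
rewrite preimage_setT.
case: (unliftP ord0 i) df cf' => [j ->|->] df cf'.
  rewrite -integral12_prod_meas1//; apply: integral0_eq => x _; rewrite /fubini_F.
  apply: (IH j (fun t => f (tuple_cons (x, t))) _ [tuple of behead a]).
  - by apply: measurableT_comp mcons _; exact: measurable_pair1.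
  - by move=> t; exact: fK.
  - move=> t nt; apply: f0 => H; apply: nt.
    have : (@tuple_cons R n @^-1` box a r) (x, t) by [].
    by rewrite tuple_cons_box => -[].
  - move=> t s; rewrite -set_coordS.
    rewrite (_ : (fun u => _) = (fun u => f (set_coord (lift ord0 j) u (tuple_cons (x, t)))))//.
    by apply/funext => u; rewrite set_coordS.
  - move=> t; rewrite (_ : (fun u => _) =
      (fun u => f' (set_coord (lift ord0 j) u (tuple_cons (x, t)))))//.
    by apply/funext => u; rewrite set_coordS.
rewrite -integral21_prod_meas1//; apply: integral0_eq => t _; rewrite /fubini_G.
apply: (@integral_derive_compact (fun x => f (tuple_cons (x, t))) _ (thead a) r) => //.
- move=> s; rewrite -(set_coord0 s 0 t).
  rewrite (_ : (fun u => _) = (fun u => f (set_coord ord0 u (tuple_cons (0, t)))))//.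
  by apply/funext => u; rewrite set_coord0.
- rewrite (_ : (fun u => _) = (fun u => f' (set_coord ord0 u (tuple_cons (0, t)))))//.
  by apply/funext => u; rewrite set_coord0.
- move=> s rs; apply: f0 => H.
  have : (@tuple_cons R n @^-1` box a r) (s, t) by [].
  by rewrite tuple_cons_box => -[/=]; rewrite in_itv/= -ler_distl distrC leNgt rs.
Qed.

End euclid.

Section rows.
Context {R : realType} {m : nat}.
Implicit Types (x y : 'rV[R]_m).

Lemma row_norm_le x (r : R) : 0 <= r -> `|x| <= r <-> forall i, `|x 0 i| <= r.
Proof.
move=> r0; rewrite [`|x|]/Num.Def.normr/= mx_normrE; split.
  move=> /bigmax_leP[_ H] i; exact: (H (0, i)).
by move=> H; apply/bigmax_leP; split => // -[i j] _; rewrite ord1.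
Qed.

Lemma open_outside (x0 : 'rV[R]_m) (r : R) : open [set x | r < `|x0 - x|].
Proof.
have c : continuous (fun x => `|x0 - x| : R).
  move=> x; apply: continuous_comp; last exact: norm_continuous.
  by apply: continuousB; [exact: cst_continuous|].
by have /continuousP/(_ [set y | r < y]) := c; apply; exact: open_gt.
Qed.

Lemma compact_closed_ball (x0 : 'rV[R]_m) (r : R) : compact [set x | `|x0 - x| <= r].
Proof.
apply: bounded_closed_compact.
  exists (`|x0| + r); split; first exact: num_real.
  move=> M rM x /= xr; rewrite (le_trans _ (ltW rM))// -[x](subrKC x0).
  by rewrite (le_trans (ler_normD _ _))// lerD2l distrC.
have -> : [set x | `|x0 - x| <= r] = ~` [set x | r < `|x0 - x|].
  by apply/seteqP; split => x /=; rewrite leNgt => /negP.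
exact/open_closedC/open_outside.
Qed.

Lemma C1U (U V : set 'rV[R]_m) (f : 'rV[R]_m -> R) :
  C_on 1 U f -> C_on 1 V f -> C_on 1 (U `|` V) f.
Proof.
move=> [dU cU] [dV cV]; split=> [x [Ux|Vx]|i x [Ux|Vx]].
- exact: dU.
- exact: dV.
- exact: cU.
- exact: cV.
Qed.

Lemma tuple_row_set_coord (k : 'I_m) (u : R) (t : m.-tuple R) :
  tuple_row (set_coord k u t) =
  (tuple_row t - tnth t k *: delta_mx 0 k) + u *: delta_mx 0 k.
Proof.
apply/rowP => j; rewrite !mxE tnth_mktuple eqxx/=.
by case: eqVneq => [->|_]; rewrite ?mulr1 ?subrr ?add0r// !mulr0 subr0 addr0.
Qed.

(** The derivative is bounded, being continuous and zero outside a compact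
    ball, and the ball of the norm of row vectors is a cube of coordinates. *)
Lemma integral_partial_row (k : 'I_m) (W : 'rV[R]_m -> R) (x0 : 'rV[R]_m) (r : R) :
  0 <= r -> C_on 1 setT W -> (forall x, r < `|x0 - x| -> W x = 0) ->
  (lebesgue_tuple R m).-integrable setT
    (fun t => (partial k W (tuple_row t))%:E) /\
  (\int[lebesgue_tuple R m]_t (partial k W (tuple_row t))%:E = 0)%E.
Proof.
move=> r0 [dW cW] W0.
pose a : m.-tuple R := [tuple x0 0 i | i < m].
have pW0 x : r < `|x0 - x| -> partial k W x = 0.
  move=> rx; rewrite (@partial_near_eq _ _ _ (cst 0)); first exact: derive_cst.
  have : \forall y \near x, r < `|x0 - y|.
    by apply: open_nbhs_nbhs; split => //; exact: open_outside.
  by apply: filterS => y; exact: W0.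
have cpW : continuous (partial k W) by move=> x; exact: cW.
have mpW : measurable_fun setT (fun t => partial k W (tuple_row t)).
  have := @measurable_tuple_row_fun R m setT (partial k W) openT (fun x _ => cpW x).
  by rewrite preimage_setT.
(* A continuous function attains its maximum on the compact ball, and the
   derivative is zero outside of it. *)
have [K pK] : exists K, forall x, `|partial k W x| <= K.
  have ne : [set x | `|x0 - x| <= r] !=set0 by exists x0; rewrite /= subrr normr0.
  have cn : {within [set x | `|x0 - x| <= r], continuous (fun x => `|partial k W x|)}.
    apply: continuous_subspaceT => x.
    by apply: continuous_comp; [exact: cpW|exact: norm_continuous].
  have [z _ zmax] := compact_EVT_max ne (@compact_closed_ball x0 r) cn.
  exists `|partial k W z| => x; have [xr|xr] := leP `|x0 - x| r; first by apply: zmax; rewrite inE.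
  by rewrite pW0// normr0.
have outside t : ~ box a r t -> r < `|x0 - tuple_row t|.
  move=> nt; rewrite ltNge; apply/negP => H; apply: nt => i.
  have := (row_norm_le (x0 - tuple_row t) r0).1 H i.
  by rewrite !mxE tnth_mktuple.
split.
  apply: (@integrable_bounded_support _ _ _ _ (box a r) _ K).
  - exact: measurable_box.
  - exact: lebesgue_tuple_box.
  - exact: mpW.
  - by move=> t; exact: pK.
  - by move=> t /outside; exact: pW0.
apply: (@integral_partial_tuple _ _ k (fun t => W (tuple_row t))
  (fun t => partial k W (tuple_row t)) a r K) => //.
- by move=> t /outside rt; rewrite W0// pW0.
- move=> t s.
  have -> : (fun u => W (tuple_row (set_coord k u t))) =
      (fun u => W ((tuple_row t - tnth t k *: delta_mx 0 k) + u *: delta_mx 0 k)).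
    by apply/funext => u; rewrite tuple_row_set_coord.
  by rewrite tuple_row_set_coord; apply: is_derive_line; exact: dW.
- move=> t.
  have -> : (fun u => partial k W (tuple_row (set_coord k u t))) =
    (fun u => partial k W ((tuple_row t - tnth t k *: delta_mx 0 k) + u *: delta_mx 0 k)).
    by apply/funext => u; rewrite tuple_row_set_coord.
  move=> u; apply: continuous_comp; last exact: cpW.
  apply: continuousD; first exact: cst_continuous.
  by apply: continuousZl.
Qed.

End rows.

(** * The divergence theorem in a coordinate ball *)

Section one_chart.
Context {R : realType} {M : ptopologicalType} {m : nat}.
Variable S : smooth_structure R M m.
Variables (g : M -> 'M[R]_m) (vol : {measure set (g_sigma_algebraType (@open M)) -> \bar R}).
Hypotheses (gS : riemannian_metric S g) (hvol : riemannian_volume S g vol).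
Implicit Types (c : chart R M m) (x : 'rV[R]_m) (p : M) (Y : M -> 'rV[R]_m).

(** Not immediate from the value of Y at p: the divergence depends on the
    first derivatives of Y, so that Y must vanish on a neighbourhood. *)
Lemma divg_near0 Y p : (\forall q \near p, Y q = 0) -> divg S g Y p = 0.
Proof.
move=> Y0; rewrite /divg; set c := chart_at S p; set x := cfwd c p.
have cp : cdom c p by exact: mem_chart_at.
have cx : cimg c x by exact: cimg_fwd.
have px : cbwd c x = p by exact: cfwdK.
have nY : \forall y \near x, vf_loc S c Y y = cst 0 y.
  have cc : cbwd c y @[y --> x] --> p by rewrite -px; exact: cbwd_cont.
  have nk : \forall y \near x, Y (cbwd c y) = 0 by exact: (cc _ Y0).
  apply: filterS nk => y /= Yy.
  by rewrite /vf_loc Yy mul0mx.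
rewrite (divergence_near_eq _ nY) /divergence big1 ?add0r ?big1// => k _.
  by rewrite mxE mulr0.
have -> : (fun y : 'rV[R]_m => (cst 0 y : 'rV[R]_m) 0 k) = (fun=> 0).
  by apply/funext => y; rewrite mxE.
exact: partial_cst.
Qed.

Lemma divg0 p : divg S g (fun _ => 0) p = 0.
Proof. by apply: divg_near0; exact: nearW. Qed.

Definition chart_density c (x : 'rV[R]_m) : R := Num.sqrt (\det (metric_loc S g c x)).

Lemma det_metric_gt0 c x : atlas S c -> cimg c x -> 0 < \det (metric_loc S g c x).
Proof. by move=> cS cx; apply: posdef_det_gt0; exact: metric_loc_posdef. Qed.

Lemma C1_det_metric c : atlas S c -> C_on 1 (cimg c) (fun x => \det (metric_loc S g c x)).
Proof. by move=> cS; apply: C1_det => [|a b]; [exact: cimg_open|exact: metric_loc_entry]. Qed.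

Lemma C1_chart_density c : atlas S c -> C_on 1 (cimg c) (chart_density c).
Proof.
move=> cS; apply: (@C1_comp1 _ _ _ _ (fun r => (2 * Num.sqrt r)^-1)).
- exact: cimg_open.
- by move=> x cx; apply: is_derive1_sqrt; exact: det_metric_gt0.
- move=> x cx; have d0 := det_metric_gt0 cS cx.
  apply: (@continuous_comp _ _ _ (fun r => 2 * Num.sqrt r) (fun r => r^-1)).
    by apply: continuousM; [exact: cst_continuous|exact: sqrt_continuous].
  by apply: inv_continuous; rewrite mulf_neq0// gt_eqF// sqrtr_gt0.
- exact: C1_det_metric.
Qed.

Let dom c := @tuple_row R m @^-1` cimg c.

Lemma measurable_chart_image c : measurable (dom c).
Proof. by apply: measurable_tuple_row_open; exact: cimg_open. Qed.

Definition chart_weight c : m.-tuple R -> R := (chart_density c \o @tuple_row R m) \_ (dom c).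

Lemma measurable_chart_weight c : atlas S c -> measurable_fun setT (chart_weight c).
Proof.
move=> cS; apply/(measurable_restrictT _ (measurable_chart_image c)).
apply: measurable_tuple_row_fun; first exact: cimg_open.
by move=> x cx; apply: C1_continuous (C1_chart_density cS) cx.
Qed.

Lemma chart_weight_ge0 c t : 0 <= chart_weight c t.
Proof. by rewrite /chart_weight patchE; case: ifP => // _; exact: sqrtr_ge0. Qed.

(** The inverse chart, made into a total measurable map: outside of the image
    of the chart the value is irrelevant, because chart_weight is zero there,
    and a constant keeps the map measurable. *)
Definition chart_inv c (t : m.-tuple R) : g_sigma_algebraType (@open M) :=
  if `[< cimg c (tuple_row t) >] then cbwd c (tuple_row t) else point.

Lemma measurable_chart_inv c : measurable_fun setT (chart_inv c).
Proof.
apply: measurable_fun_borel => W oW.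
have -> : chart_inv c @^-1` W =
    (@tuple_row R m @^-1` [set x | cimg c x /\ W (cbwd c x)]) `|`
    (if `[< W point >] then ~` dom c else set0).
  apply/seteqP; split => [t|t]; rewrite /= /chart_inv.
    case: asboolP => [ct Wt|nt Wp]; first by left.
    by right; rewrite asboolT.
  move=> [[ct Wt]|]; first by rewrite asboolT.
  by case: asboolP => // Wp nt; rewrite asboolF.
apply: measurableU.
  by apply: measurable_tuple_row_open; exact: open_cimg_preimage.
by case: asboolP => // _; apply: measurableC; exact: measurable_chart_image.
Qed.

(** The volume is only prescribed on sets; integral_density passes to
    functions. *)
Lemma integral_chart c (f : M -> R) : atlas S c ->
  measurable_fun (cdom c : set (g_sigma_algebraType (@open M))) f ->
  (\int[vol]_(p in cdom c) (f p)%:E =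
   \int[lebesgue_tuple R m]_(t in chart_inv c @^-1` cdom c)
     (f (chart_inv c t) * chart_weight c t)%:E)%E.
Proof.
move=> cS mf; apply: integral_density => //.
- exact: measurable_chart_inv.
- exact: measurable_chart_weight.
- exact: chart_weight_ge0.
- by apply: borel_open; exact: cdom_open.
move=> A mA Ac; rewrite (hvol cS mA Ac).
apply: (etrans (integral_mkcond _ _)); apply/esym; apply: (etrans (integral_mkcond _ _)).
apply/esym; apply: eq_integral => t _.
rewrite !patchE /chart_weight /chart_inv !patchE.
have [ct|nct] := pselect (cimg c (tuple_row t)); last first.
  rewrite (memNset (A := dom c))//=; rewrite ifF; last first.
    by apply: memNset => -[q Aq qt]; apply: nct; rewrite /tuple_row -qt; apply: cimg_fwd; exact: Ac.
  by case: ifP.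
have [cq qt] := cimgP ct.
rewrite [in RHS](mem_set (A := dom c))//=.
have [At|At] := pselect (A (cbwd c (tuple_row t))).
  rewrite mem_set/=; last by exists (cbwd c (tuple_row t)).
  by rewrite mem_set//= asboolT.
rewrite memNset/=; last first.
  by move=> [q Aq qtt]; apply: At; rewrite /tuple_row -qtt cfwdK//; exact: Ac.
by rewrite memNset//= asboolT.
Qed.

(** A coordinate ball is compact as the image of a closed ball of R^m, and
    closed since the manifold is Hausdorff. This is what keeps an object
    supported in the ball from having its support accumulate outside of the
    chart. *)
Lemma closed_chart_ball c x0 (r : R) : [set x | `|x0 - x| <= r] `<=` cimg c ->
  closed [set p | cdom c p /\ `|x0 - cfwd c p| <= r].
Proof.
move=> Bc.
have -> : [set p | cdom c p /\ `|x0 - cfwd c p| <= r] =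
    cbwd c @` [set x | `|x0 - x| <= r].
  apply/seteqP; split => [p [cp xp]|_ [x xr <-]] /=.
    by exists (cfwd c p) => //; exact: cfwdK.
  by have [cp xE] := cimgP (Bc x xr); split => //; rewrite xE.
apply: compact_closed; first exact: (manifold_hausdorff S).
apply: continuous_compact; last exact: compact_closed_ball.
apply: continuous_in_subspaceT => x; rewrite inE => xr.
by apply: cbwd_cont; exact: Bc.
Qed.

(** The functions sqrt (det g) Y^k, extended by zero to R^m, are of class C1
    because the support stays inside the image of the chart; their partial
    derivatives integrate to zero and sum up to sqrt (det g) div Y. *)
Lemma integral_divg_chart c x0 (r : R) Y : atlas S c -> 0 <= r ->
  [set x | `|x0 - x| <= r] `<=` cimg c -> C1_vf S Y ->
  (forall p, ~ (cdom c p /\ `|x0 - cfwd c p| <= r) -> Y p = 0) ->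
  measurable_fun [set: g_sigma_algebraType (@open M)] (divg S g Y) ->
  (\int[vol]_p (divg S g Y p)%:E = 0)%E.
Proof.
move=> cS r0 Bc Y1 Y0 mdiv.
pose K := [set p | cdom c p /\ `|x0 - cfwd c p| <= r].
have clK : closed K by exact: closed_chart_ball.
have div0 p : ~ K p -> divg S g Y p = 0.
  move=> nK; apply: divg_near0.
  have : \forall q \near p, (~` K) q by apply: open_nbhs_nbhs; split => //; exact: closed_openC.
  by apply: filterS => q; exact: Y0.
(* The field sqrt (det g) Y in coordinates, extended by zero. *)
pose W k x := if `[< cimg c x >] then chart_density c x * vf_loc S c Y x 0 k else 0.
have W0 k x : r < `|x0 - x| -> W k x = 0.
  move=> rx; rewrite /W; case: asboolP => // cx; have [cp xE] := cimgP cx.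
  rewrite /vf_loc Y0 ?mul0mx ?mxE ?mulr0// => -[_].
  by rewrite xE leNgt rx.
have W1 k : C_on 1 setT (W k).
  have -> : setT = cimg c `|` [set x | r < `|x0 - x|].
    apply/seteqP; split => // x _; have [xr|xr] := leP `|x0 - x| r; last by right.
    by left; exact: Bc.
  apply: C1U.
    apply: (@C_on_eq _ _ _ 1 _ (fun x => chart_density c x * vf_loc S c Y x 0 k)).
    - exact: cimg_open.
    - by move=> x cx; rewrite /W asboolT.
    - apply: C1M; [exact: cimg_open|exact: C1_chart_density|exact: Y1].
  apply: (@C_on_eq _ _ _ 1 _ (fun=> 0)); [exact: open_outside| |exact: C1_cst].
  by move=> x rx; rewrite W0.
have W0' k x : r < `|x0 - x| -> partial k (W k) x = 0.
  move=> rx; rewrite (@partial_near_eq _ _ _ (fun=> 0)); first exact: partial_cst.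
  have : \forall y \near x, r < `|x0 - y|.
    by apply: open_nbhs_nbhs; split => //; exact: open_outside.
  by apply: filterS => y; exact: W0.
have divE x : cimg c x ->
    divg S g Y (cbwd c x) * chart_density c x = \sum_k partial k (W k) x.
  move=> cx; rewrite divg_chart// mulrC /chart_density -divergence_sqrt_det.
  - apply: eq_bigr => k _; apply: partial_near_eq.
    by apply: filterS (near_cimg cx) => y cy; rewrite /W asboolT.
  - by move=> a b; have [+ _] := metric_loc_entry a b 1 gS cS; apply.
  - exact: det_metric_gt0.
  - by move=> k; have [+ _] := Y1 c cS k; apply.
transitivity (\int[vol]_(p in cdom c) (divg S g Y p)%:E)%E.
  rewrite [RHS]integral_mkcond; apply: eq_integral => p _; rewrite patchE.
  case: ifPn => // pc; rewrite div0// => -[cp _]; move/negP: pc; apply; exact: mem_set.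
rewrite integral_chart//; last exact: measurable_funTS.
transitivity (\int[lebesgue_tuple R m]_t (\sum_k (partial k (W k) (tuple_row t))%:E))%E.
  rewrite integral_mkcond; apply: eq_integral => t _; rewrite patchE.
  rewrite sumEFin /chart_weight patchE.
  have [ct|nct] := pselect (cimg c (tuple_row t)).
    have [cp _] := cimgP ct.
    have tE : chart_inv c t = cbwd c (tuple_row t) by rewrite /chart_inv asboolT.
    by rewrite mem_set/= ?tE// mem_set//= divE.
  rewrite (memNset (A := dom c))//= mulr0 big1; first by case: ifP.
  by move=> k _; apply: W0'; rewrite ltNge; apply/negP => /Bc.
rewrite integral_sum//; last first.
  by move=> k; have [] := integral_partial_row k r0 (W1 k) (W0 k).
by rewrite big1// => k _; have [] := integral_partial_row k r0 (W1 k) (W0 k).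
Qed.

End one_chart.

(** * Cut-off functions *)

Section plateau.
Context {R : realType}.
Implicit Types s : R.

(** The simplest C1 function that is zero exactly on a half line. *)
Definition pos_sq s : R := Num.max 0 s ^+ 2.

Lemma is_derive_pos_sq s : is_derive s 1 pos_sq (2 * Num.max 0 s).
Proof.
have [s0|s0|->] := ltgtP s 0.
- rewrite mulr0.
  have H : is_derive s 1 (cst 0 : R -> R) 0 by exact: is_derive_cst.
  apply: near_eq_is_derive H.
  have : \forall x \near s, x < 0 by exact: lt_nbhsl.
  by apply: filterS => x x0; rewrite /pos_sq max_l ?expr0n// ltW.
- have H : is_derive s 1 (fun x : R => x ^+ 2) (2 * s).
    apply: DeriveDef; first exact: exprn_derivable.
    by rewrite exp_derive expr1; exact: mulr1.
  apply: near_eq_is_derive H.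
  have : \forall x \near s, 0 < x by exact: lt_nbhsr.
  by apply: filterS => x x0; rewrite /pos_sq max_r// ltW.
rewrite ?maxxx mulr0.
have lim0 : h^-1 *: ((pos_sq \o shift 0) (h *: 1) - pos_sq 0) @[h --> 0^'] --> (0 : R).
  apply/cvgrPdist_lt => e e0; near=> h.
  have h0 : h != 0 by near: h; exact: nbhs_dnbhs_neq.
  rewrite /= addr0 sub0r normrN /pos_sq maxxx expr0n subr0.
  have -> : h *: (1 : R) = h by exact: mulr1.
  rewrite -[h^-1 *: _]/(h^-1 * _).
  have [hn|hp] := leP h 0; first by rewrite expr0n mulr0 normr0.
  rewrite expr2 mulKf//.
  by near: h; exact: dnbhs0_lt.
by split; [apply/cvg_ex; exists 0; exact: lim0|exact: cvg_lim lim0].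
Unshelve. all: by end_near. Qed.

Lemma continuous_max0 : continuous (fun s => Num.max 0 s : R).
Proof. by move=> s; apply: continuous_max; [exact: cst_continuous|]. Qed.

Lemma C1_pos_sq {m : nat} (U : set 'rV[R]_m) (f : 'rV[R]_m -> R) : open U ->
  C_on 1 U f -> C_on 1 U (fun x => pos_sq (f x)).
Proof.
move=> oU; apply: (@C1_comp1 _ _ _ _ (fun s => 2 * Num.max 0 s)); first exact: oU.
  by move=> x _; exact: is_derive_pos_sq.
move=> x _; apply: continuousM; first exact: cst_continuous.
exact: continuous_max0.
Qed.

(** A C1 step: 0 for s <= 0 and 1 for s >= 1. Being of class C1 is enough, and
    spares the exponential bump functions. *)
Definition plateau s : R := 1 - pos_sq (1 - pos_sq s).

Lemma plateau0 s : s <= 0 -> plateau s = 0.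
Proof.
move=> s0; rewrite /plateau {2}/pos_sq max_l// expr0n subr0 /pos_sq max_r ?ler01//.
by rewrite expr1n subrr.
Qed.

Lemma plateau1 s : 1 <= s -> plateau s = 1.
Proof.
move=> s1; have s0 : 0 <= s by exact: le_trans ler01 s1.
rewrite /plateau {2}/pos_sq max_r// /pos_sq max_l; first by rewrite expr0n subr0.
by rewrite subr_le0 exprn_ege1.
Qed.

Context {m : nat}.

(** The argument of plateau is at least 1 when the coordinate differs from
    that of x0 by at most r, and at most 0 when it differs by at least 2 r. *)
Definition cube_bump (x0 : 'rV[R]_m) (r : R) (x : 'rV[R]_m) : R :=
  \prod_i plateau (2 - ((x 0 i - x0 0 i) / r) ^+ 2).

Lemma C1_id (U : set 'rV[R]_m) : C_on 1 U (id : 'rV[R]_m -> 'rV[R]_m).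
Proof.
split=> [x _|i x _]; first by [].
have -> : (fun x : 'rV[R]_m => 'D_(delta_mx 0 i) id x) = cst (delta_mx 0 i).
  by apply/funext => y; exact: derive_id.
exact: cst_continuous.
Qed.

Lemma C1_cstB (U : set 'rV[R]_m) (a : R) (f : 'rV[R]_m -> R) : open U ->
  C_on 1 U f -> C_on 1 U (fun x => a - f x).
Proof.
move=> oU f1.
apply: (@C_on_eq _ _ _ 1 U (fun x => a + (- 1 * f x))); first exact: oU.
  by move=> x _; rewrite mulN1r.
apply: C1D; [exact: oU|exact: C1_cst|].
by apply: C1M; [exact: oU|exact: C1_cst|exact: f1].
Qed.

Lemma C1_cube_bump x0 r : C_on 1 setT (cube_bump x0 r).
Proof.
have oT := @openT 'rV[R]_m.
apply: C1_prod; first exact: oT.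
move=> i; apply: C1_cstB; first exact: oT.
apply: C1_pos_sq; first exact: oT.
apply: C1_cstB; first exact: oT.
apply: C1_pos_sq; first exact: oT.
apply: C1_cstB; first exact: oT.
have cX : C_on 1 setT (fun x : 'rV[R]_m => (x 0 i - x0 0 i) / r).
  apply: C1M; [exact: oT| |exact: C1_cst].
  apply: C1D; [exact: oT| |exact: C1_cst].
  exact: (C_on_entry (k := 1) 0 i oT (C1_id setT)).
exact: (C1M oT cX cX).
Qed.

Lemma cube_bump1 x0 r x : 0 < r -> `|x0 - x| <= r -> cube_bump x0 r x = 1.
Proof.
move=> r0 xr; rewrite /cube_bump big1// => i _; apply: plateau1.
have := (row_norm_le (x0 - x) (ltW r0)).1 xr i; rewrite !mxE => xi.
have : ((x 0 i - x0 0 i) / r) ^+ 2 <= 1.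
  rewrite -real_normK ?num_real// expr_le1// normrM normfV (gtr0_norm r0).
  by rewrite ler_pdivrMr// mul1r distrC.
by move=> H; lra.
Qed.

Lemma cube_bump0 x0 r x : 0 < r -> 2 * r < `|x0 - x| -> cube_bump x0 r x = 0.
Proof.
move=> r0 xr; have [i xi] : exists i, 2 * r < `|(x0 - x) 0 i|.
  apply/not_existsP => H; move: xr; rewrite ltNge => /negP; apply.
  apply/(row_norm_le _ _).2; first by rewrite mulr_ge0// ltW.
  by move=> i; rewrite leNgt; apply/negP; exact: H.
rewrite /cube_bump (bigD1 i)//= plateau0 ?mul0r// subr_le0.
rewrite -real_normK ?num_real// normrM normfV (gtr0_norm r0).
have h : 2 <= `|x 0 i - x0 0 i| / r.
  by rewrite ler_pdivlMr// distrC ltW//; rewrite !mxE in xi.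
rewrite (le_trans h)// ler_eXnr//; apply: le_trans h; lra.
Qed.

End plateau.

(** * The divergence theorem on a closed manifold *)

Section closed_manifold.
Context {R : realType} {M : ptopologicalType} {m : nat}.
Variable S : smooth_structure R M m.
Variables (g : M -> 'M[R]_m) (vol : {measure set (g_sigma_algebraType (@open M)) -> \bar R}).
Hypotheses (gS : riemannian_metric S g) (hvol : riemannian_volume S g vol).
Hypothesis (hM : compact [set: M]).
Implicit Types (c d : chart R M m) (x : 'rV[R]_m) (p : M) (Y : M -> 'rV[R]_m).

Lemma open_dom_preimage c (V : set 'rV[R]_m) : open V ->
  open [set p | cdom c p /\ V (cfwd c p)].
Proof.
move=> oV; rewrite openE => p [cp Vp]; apply: filterI.
  by apply: open_nbhs_nbhs; split => //; exact: cdom_open.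
by apply: (cfwd_cont cp); exact: open_nbhs_nbhs.
Qed.

Lemma dlog_density_det c x j : atlas S c -> cimg c x ->
  dlog_density (metric_loc S g c) j x =
  2^-1 * ((\det (metric_loc S g c x))^-1 *
    partial j (fun y => \det (metric_loc S g c y)) x).
Proof.
move=> cS cx; rewrite partial_det; last first.
  by move=> a b; have [+ _] := metric_loc_entry a b 1 gS cS; apply.
by rewrite /dlog_density /invmx (posdef_unit (metric_loc_posdef gS cS cx)) -scalemxAl mxtraceZ.
Qed.

(** The only doubtful term is the inverse metric in dlog_density, which
    dlog_density_det replaces by the inverse of a nonzero determinant. *)
Lemma divergence_continuous c Y x : atlas S c -> C1_vf S Y -> cimg c x ->
  {for x, continuous (divergence (metric_loc S g c) (vf_loc S c Y))}.
Proof.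
move=> cS Y1 cx; apply: continuousD; apply: continuous_at_sum => k.
  by have [_ cY] := Y1 c cS k; exact: cY.
apply: continuousM; last exact: C1_continuous (Y1 c cS k) cx.
apply: (@C_on_eq _ _ _ 0 (cimg c) (fun x => 2^-1 * ((\det (metric_loc S g c x))^-1 *
    partial k (fun y => \det (metric_loc S g c y)) x))); last exact: cx.
- exact: cimg_open.
- by move=> y cy; rewrite dlog_density_det.
move=> y cy; have d1 := C1_det_metric gS cS.
apply: continuousM; first exact: cst_continuous.
apply: continuousM; last by have [_ cd] := d1; exact: cd.
apply: (@continuous_comp _ _ _ (fun y => \det (metric_loc S g c y)) (fun r => r^-1)).
  exact: C1_continuous d1 cy.
by apply: inv_continuous; rewrite gt_eqF// det_metric_gt0.
Qed.

Lemma divg_continuous Y : C1_vf S Y -> continuous (divg S g Y).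
Proof.
move=> Y1 p; pose c := chart_at S p.
have cS : atlas S c by exact: atlas_chart_at.
have cp : cdom c p by exact: mem_chart_at.
pose f q := divergence (metric_loc S g c) (vf_loc S c Y) (cfwd c q).
have fE q : cdom c q -> f q = divg S g Y q.
  move=> cq; have E := divg_chart gS Y1 cS (cimg_fwd cq).
  by rewrite (cfwdK cq) in E; exact (esym E).
have nfE : \forall q \near p, f q = divg S g Y q.
  have : \forall q \near p, cdom c q by apply: open_nbhs_nbhs; split => //; exact: cdom_open.
  by apply: filterS => q; exact: fE.
have cf : f q @[q --> p] --> f p.
  apply: (@continuous_comp _ _ _ (cfwd c)); first exact: cfwd_cont.
  by apply: divergence_continuous => //; exact: cimg_fwd.
rewrite /continuous_at -(fE p cp).
exact: cvg_trans (near_eq_cvg nfE) cf.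
Qed.

Lemma finite_cover (W : M -> set M) : (forall p, open (W p)) -> (forall p, W p p) ->
  exists s : seq M, forall q, exists2 p, p \in s & W p q.
Proof.
move=> oW Wp; move: hM; rewrite compact_cover => /(_ M setT W).
case=> [p _|q _|D _ cov]; first exact: oW.
  by exists q.
exists (finmap.enum_fset D) => q; have [p pD Wpq] := cov q I.
by exists p.
Qed.

(** The density of the volume is bounded on a small coordinate ball, by
    continuity. *)
Lemma vol_locally_finite p : exists W : set M, [/\ open W, W p & (vol W < +oo)%E].
Proof.
pose c := chart_at S p; have cS : atlas S c by exact: atlas_chart_at.
have cp : cdom c p by exact: mem_chart_at.
pose x := cfwd c p; have cx : cimg c x by exact: cimg_fwd.
pose K := chart_density S g c x + 1.
have K0 : 0 <= K by rewrite addr_ge0// sqrtr_ge0.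
have nK : \forall y \near x, chart_density S g c y < K.
  have := C1_continuous (C1_chart_density gS cS) cx.
  move=> /cvgr_lt; apply; by rewrite ltrDl.
have [r r0 rP] : exists2 r : R, 0 < r & forall y, `|x - y| < r ->
    cimg c y /\ chart_density S g c y < K.
  have nn : nbhs x [set y | cimg c y /\ chart_density S g c y < K].
    exact: (filterI (near_cimg cx) nK).
  have /nbhs_ballP[r r0 rP] := nn.
  by exists r => // y xy; apply: rP; rewrite -ball_normE.
pose V := [set y | `|x - y| < r] : set 'rV[R]_m.
have oV : open V.
  rewrite (_ : V = ball x r); first exact: ball_open.
  by rewrite -ball_normE.
exists [set q | cdom c q /\ V (cfwd c q)]; split.
- exact: open_dom_preimage.
- by split => //; rewrite /V /= -/x subrr normr0.
set A := [set q | _].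
have oA : open A by exact: open_dom_preimage.
rewrite (hvol cS); [|exact: borel_open|by move=> q []].
have DE : [set t : m.-tuple R | (cfwd c @` A) (\row_i tnth t i)] = @tuple_row R m @^-1` V.
  apply/seteqP; split => t /=; first by move=> [q [_ Vq] qt]; rewrite /tuple_row -qt.
  move=> Vt; have [ct _] := rP _ Vt; have [cq qt] := cimgP ct.
  by exists (cbwd c (tuple_row t)); [split => //; rewrite qt|exact: qt].
rewrite DE.
have mD : measurable (@tuple_row R m @^-1` V) by exact: measurable_tuple_row_open.
have mf : measurable_fun (@tuple_row R m @^-1` V)
    (fun t => chart_density S g c (tuple_row t)).
  apply: measurable_tuple_row_fun => // y Vy.
  by apply: C1_continuous (C1_chart_density gS cS) _; have [] := rP y Vy.
apply: (@le_lt_trans _ _ (K%:E * lebesgue_tuple R m (@tuple_row R m @^-1` V))%E).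
  rewrite -integral_cst//; apply: ge0_le_integral => //.
  - exact/measurable_EFinP.
  - by move=> t Vt; rewrite lee_fin ltW//; have [] := rP _ Vt.
apply: lte_mul_pinfty => //.
pose a : m.-tuple R := [tuple x 0 i | i < m].
apply: le_lt_trans (lebesgue_tuple_box a r).
apply: le_measure; rewrite ?inE//; first exact: measurable_box.
move=> t Vt i; have := (row_norm_le (x - tuple_row t) (ltW r0)).1 (ltW Vt) i.
by rewrite !mxE tnth_mktuple.
Qed.

Lemma vol_finite : (vol setT < +oo)%E.
Proof.
have [W WP] := choice vol_locally_finite.
have [s cov] : exists s : seq M, forall q, exists2 p, p \in s & W p q.
  by apply: finite_cover => p; have [] := WP p.
have mW p : measurable (W p : set (g_sigma_algebraType (@open M))).
  by apply: borel_open; have [] := WP p.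
have -> : setT = \big[setU/set0]_(p <- s) W p.
  apply/seteqP; split => // q _; have [p ps Wpq] := cov q.
  by rewrite -bigcup_seq; exists p.
elim: s {cov} => [|p s IH]; first by rewrite big_nil measure0.
rewrite big_cons; apply: le_lt_trans (measureU2 _ _ _) _ => //.
  by apply: bigsetU_measurable.
by rewrite lte_add_pinfty//; have [] := WP p.
Qed.

Lemma divg_measurable Y : C1_vf S Y ->
  measurable_fun [set: g_sigma_algebraType (@open M)] (divg S g Y).
Proof. by move=> Y1; apply: borel_continuous_measurable; exact: divg_continuous. Qed.

Lemma divg_integrable Y : C1_vf S Y -> vol.-integrable setT (EFin \o divg S g Y).
Proof.
move=> Y1; apply: measurable_bounded_integrable => //.
- exact: vol_finite.
- exact: divg_measurable.
have ne : [set: M] !=set0 by exists point.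
have cn : {within [set: M], continuous (fun p => `|divg S g Y p|)}.
  apply: continuous_subspaceT => p.
  by apply: continuous_comp; [exact: divg_continuous|exact: norm_continuous].
have [z _ zmax] := compact_EVT_max ne hM cn.
exists `|divg S g Y z|; split; first exact: num_real.
by move=> u zu p _; apply: le_trans (ltW zu); apply: zmax; rewrite inE.
Qed.

Lemma divgD Y Z p : C1_vf S Y -> C1_vf S Z ->
  divg S g (fun q => Y q + Z q) p = divg S g Y p + divg S g Z p.
Proof.
move=> Y1 Z1; rewrite /divg; have cS := atlas_chart_at S p.
have cx := cimg_fwd (mem_chart_at S p).
have -> : vf_loc S (chart_at S p) (fun q => Y q + Z q) =
    (fun y => vf_loc S (chart_at S p) Y y + vf_loc S (chart_at S p) Z y).
  by apply/funext => y; rewrite /vf_loc mulmxDl.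
apply: divergenceD.
- by move=> k; have [+ _] := Y1 _ cS k; apply.
- by move=> k; have [+ _] := Z1 _ cS k; apply.
Qed.

Section bump.
Variables (c : chart R M m) (x0 : 'rV[R]_m) (r : R).
Hypotheses (cS : atlas S c) (r0 : 0 < r).
Hypothesis Bc : [set x | `|x0 - x| <= 2 * r] `<=` cimg c.

Definition chart_bump (q : M) : R :=
  if `[< cdom c q >] then cube_bump x0 r (cfwd c q) else 0.

Lemma chart_bump1 q : cdom c q -> `|x0 - cfwd c q| <= r -> chart_bump q = 1.
Proof. by move=> cq qr; rewrite /chart_bump asboolT// cube_bump1. Qed.

Lemma chart_bump0 q : ~ (cdom c q /\ `|x0 - cfwd c q| <= 2 * r) -> chart_bump q = 0.
Proof.
rewrite /chart_bump; case: asboolP => // cq H; apply: cube_bump0 => //.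
by rewrite ltNge; apply/negP => qr; apply: H.
Qed.

(** In another chart d, the bump is a composite with a transition map on the
    overlap, and zero on the preimage of the complement of the closed
    coordinate ball; these two open sets cover the image of d. *)
Lemma C1_chart_bump d : atlas S d -> C_on 1 (cimg d) (fun x => chart_bump (cbwd d x)).
Proof.
move=> dS; have dc : compatible d c by exact: (@atlas_compatible _ _ _ S).
pose K := [set p | cdom c p /\ `|x0 - cfwd c p| <= 2 * r].
have clK : closed K by exact: (closed_chart_ball S Bc).
pose V := [set x | cimg d x /\ (~` K) (cbwd d x)].
have oV : open V by apply: open_cimg_preimage; exact: closed_openC.
have -> : cimg d = overlap d c `|` V.
  apply/seteqP; split => [x dx|x]; last by rewrite overlapE => -[[]|[]].
  have [cx|ncx] := pselect (cdom c (cbwd d x)); first by left; rewrite overlapE.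
  by right; split => // -[].
apply: C1U.
  apply: (@C_on_eq _ _ _ 1 _ (fun x => cube_bump x0 r (transition d c x))).
  - exact: open_overlap.
  - by move=> _ [p [dp cp] <-]; rewrite transition_fwd// /chart_bump cfwdK// asboolT.
  - apply: (@C1_comp _ _ _ _ setT).
    + exact: open_overlap.
    + by [].
    + exact: (proj1 dc 1%N).
    + exact: C1_cube_bump.
apply: (@C_on_eq _ _ _ 1 _ (fun=> 0)); [exact: oV| |exact: C1_cst].
by move=> x [dx nK]; rewrite chart_bump0.
Qed.

Lemma C1_vf_bump Y : C1_vf S Y -> C1_vf S (fun q => chart_bump q *: Y q).
Proof.
move=> Y1 d dS k; have od : open (cimg d) by exact: cimg_open.
apply: (@C_on_eq _ _ _ 1 _ (fun x => chart_bump (cbwd d x) * vf_loc S d Y x 0 k)).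
- exact: od.
- by move=> x _; rewrite /vf_loc -scalemxAl [RHS]mxE.
by apply: C1M; [exact: od|exact: C1_chart_bump|exact: Y1].
Qed.

Lemma C1_vf_bumpC Y : C1_vf S Y -> C1_vf S (fun q => (1 - chart_bump q) *: Y q).
Proof.
move=> Y1 d dS k; have od : open (cimg d) by exact: cimg_open.
apply: (@C_on_eq _ _ _ 1 _ (fun x => (1 - chart_bump (cbwd d x)) * vf_loc S d Y x 0 k)).
- exact: od.
- by move=> x _; rewrite /vf_loc -scalemxAl [RHS]mxE.
apply: C1M; [exact: od| |exact: Y1].
by apply: C1_cstB; [exact: od|exact: C1_chart_bump].
Qed.

Lemma integral_divg_bump Y : C1_vf S Y ->
  (\int[vol]_p (divg S g (fun q => chart_bump q *: Y q) p)%:E = 0)%E.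
Proof.
move=> Y1; have bY1 := C1_vf_bump Y1.
apply: (@integral_divg_chart _ _ _ S g vol gS hvol c x0 (2 * r)) => //.
- by rewrite mulr_ge0// ltW.
- by move=> q nq; rewrite chart_bump0// scale0r.
- exact: divg_measurable.
Qed.

End bump.

(** Induction on the finite cover: for a bump b equal to 1 on the first piece,
    the field (1 - b) Y has the same integral of the divergence as Y and
    vanishes on that piece as well. *)
Lemma integral_divg Y : C1_vf S Y -> (\int[vol]_p (divg S g Y p)%:E = 0)%E.
Proof.
have rex p : exists r, 0 < r /\
    [set x | `|cfwd (chart_at S p) p - x| <= 2 * r] `<=` cimg (chart_at S p).
  have cx := cimg_fwd (mem_chart_at S p).
  have nn : nbhs (cfwd (chart_at S p) p) (cimg (chart_at S p)) by exact: near_cimg.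
  have /nbhs_ballP[e e0 eP] := nn.
  have e0' : (0 : R) < e by [].
  (* The bump of size r is supported in the ball of radius 2 r, which has to be
     contained in the ball of radius e. *)
  exists (e / 4); split; first by rewrite divr_gt0.
  move=> x /= xe; apply: eP; rewrite -ball_normE/= (le_lt_trans xe)//.
  by lra.
have [r rP] := choice rex.
pose c p := chart_at S p; pose x0 p := cfwd (c p) p.
pose W p := [set q | cdom (c p) q /\ `|x0 p - cfwd (c p) q| < r p].
have [s cov] : exists s : seq M, forall q, exists2 p, p \in s & W p q.
  apply: finite_cover => p.
    apply: (@open_dom_preimage (c p) [set y | `|x0 p - y| < r p]).
    rewrite (_ : [set y | _] = ball (x0 p) (r p)); first exact: ball_open.
    by rewrite -ball_normE.
  by split; [exact: mem_chart_at|rewrite subrr normr0; have [] := rP p].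
move=> Y1; have : forall q, (forall p, p \in s -> ~ W p q) -> Y q = 0.
  by move=> q H; have [p ps Wpq] := cov q; case: (H p ps Wpq).
elim: s Y Y1 {cov} => [|p s IH] Y Y1 Y0.
  have -> : Y = fun _ => 0 by apply/funext => q; apply: Y0.
  by apply: integral0_eq => q _; rewrite divg0.
have [r0 Bc] := rP p; have cS : atlas S (c p) by exact: atlas_chart_at.
pose b := chart_bump (c p) (x0 p) (r p).
have b1 := C1_vf_bump cS r0 Bc Y1; have b2 := C1_vf_bumpC cS r0 Bc Y1.
transitivity (\int[vol]_q ((divg S g (fun q => b q *: Y q) q)%:E +
    (divg S g (fun q => (1 - b q) *: Y q) q)%:E))%E.
  apply: eq_integral => q _; rewrite -EFinD -(divgD q b1 b2).
  have -> // : (fun z => b z *: Y z + (1 - b z) *: Y z) = Y.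
  by apply/funext => z; rewrite -scalerDl addrC subrK scale1r.
apply: etrans (integralD measurableT (divg_integrable b1) (divg_integrable b2)) _.
rewrite integral_divg_bump// add0e; apply: IH => // q nW.
have [Wq|nWq] := pselect (W p q).
  have [cq qr] := Wq; rewrite /b chart_bump1 ?subrr ?scale0r//; exact: ltW.
rewrite Y0 ?scaler0// => p'; rewrite inE => /orP[/eqP ->//|]; exact: nW.
Qed.

End closed_manifold.

(** * The integral of sigma1 *)

Theorem theorem2 (R : realType) (m n : nat) (M : ptopologicalType)
    (S : smooth_structure R M m) (g : M -> 'M[R]_m) (D : M -> 'M[R]_m)
    (F : foliation S n) (N : M -> 'rV[R]_m)
    (vol : {measure set (g_sigma_algebraType (@open M)) -> \bar R})
    (hn : (0 < n < m)%N)
    (hM : compact [set: M])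
    (hg : riemannian_metric S g)
    (hD : smooth_distribution S n.+1 D)
    (hF : forall p, (fol_tangent F p <= D p)%MS)
    (hNsmooth : smooth_vf S [set: M] N)
    (hNunit : forall p, inner g p (N p) (N p) = 1)
    (hND : forall p, (N p <= D p)%MS)
    (hNF : forall p, (N p <= orth g (fol_tangent F) p)%MS)
    (hvol : riemannian_volume S g vol)
    (harm : perp_harmonic S g D) :
  (\int[vol]_p (sigma1 g D F N p)%:E = 0)%E.
Proof.
have nm : (n <= m)%N by case/andP: hn => _ /ltnW.
have N1 : C1_vf S N by exact: smooth_vf_C1.
transitivity (\int[vol]_p ((-1)%:E * (divg S g N p)%:E))%E.
  apply: eq_integral => p _; rewrite -EFinM mulN1r; congr (_%:E).
  exact: (sigma1_divg nm hg hD hF hNsmooth hNunit hND hNF (harm p)).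
apply: etrans (integralZl measurableT (divg_integrable hg hvol hM N1) (-1)) _.
by rewrite (integral_divg hg hvol hM N1) mule0.
Qed.
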